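(* Let $f:\mathbb{C}\to\widehat{\mathbb{C}}$ be a transcendental meromorphic function which has a Baker wandering domain. Then the image under $f$ of every unbounded curve in $\mathbb{C}$ is unbounded. In particular, if a transcendental meromorphic function $f:\mathbb{C}\to\widehat{\mathbb{C}}$ has a finite asymptotic value, then $f$ has no Baker wandering domain.
   Context: $\widehat{\mathbb{C}}=\mathbb{C}\cup\{\infty\}$. A transcendental meromorphic function $f:\mathbb{C}\to\widehat{\mathbb{C}}$ is meromorphic on $\mathbb{C}$ with its single essential singularity at $\infty$; it may have finitely many, infinitely many, or no poles (it is called entire if it has no pole). $f^n$ denotes the $n$-fold iterate. The Fatou set of $f$ is the set of points of $\widehat{\mathbb{C}}$ having a neighborhood on which all iterates $f^n$ are defined and form a normal family; a Fatou component is a connected component of the Fatou set. For a Fatou component $W$, $W_n$ denotes the Fatou component containing $f^n(W)$ ($W_0=W$). $W$ is wandering if $W_m\cap W_n=\emptyset$ for all $m\neq n$. A domain $U$ is multiply connected if $\widehat{\mathbb{C}}\setminus U$ has more than one component. A set $A$ surrounds a set (or point) $B$ if $B$ is contained in a bounded component of $\widehat{\mathbb{C}}\setminus A$. A Baker wandering domain of $f$ is a wandering domain $W$ of $f$ such that for all sufficiently large $n$, $W_n$ is multiply connected, bounded and surrounds $0$, with $\mathrm{dist}(W_n,0)\to\infty$ and $f^n(z)\to\infty$ as $n\to\infty$ for all $z\in W$. A point $a\in\widehat{\mathbb{C}}$ is an asymptotic value of $f$ if there is a curve $\gamma:[0,\infty)\to\mathbb{C}$ with $\lim_{t\to\infty}\gamma(t)=\infty$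 and $\lim_{t\to\infty}f(\gamma(t))=a$; it is finite if $a\in\mathbb{C}$. A set is unbounded if it is not contained in any bounded subset of $\mathbb{C}$. *)

(* Defs.v *)
From HB Require Import structures.
From mathcomp Require Import all_boot all_order all_algebra.
From mathcomp Require Import all_classical all_reals all_analysis.
From mathcomp Require Export complex.

Set Implicit Arguments.
Unset Strict Implicit.
Unset Printing Implicit Defensive.

Import Order.TTheory GRing.Theory Num.Theory.
Import numFieldNormedType.Exports.

Local Open Scope classical_set_scope.
Local Open Scope ring_scope.

(* [R[i]^o] rather than [R[i]]: it is the alias that carries the topology and
   the structure of normed module over R[i]. *)
Notation Cplx R := (R[i]^o)%type.

(* The point at infinity is [None]. *)
Notation sphere R := (one_point_compactification (Cplx R)).

Section Sphere.
Variable R : realType.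
Local Notation C := (Cplx R).
Local Notation S := (sphere R).
Implicit Types (A B K U : set S) (z w : S).

(* The norm `|z| of R[i] takes its values in R[i]; [Normc.normc] is the same
   norm with values in R. *)
Definition modulus (z : C) : R := Normc.normc z.

Definition chordal z w : R :=
  match z, w with
  | Some x, Some y => 2 * modulus (x - y) /
      (Num.sqrt (1 + modulus x ^+ 2) * Num.sqrt (1 + modulus y ^+ 2))
  | Some x, None | None, Some x => 2 / Num.sqrt (1 + modulus x ^+ 2)
  | None, None => 0
  end.

(* In particular, a set that contains infinity is not bounded. *)
Definition sphere_bounded A : Prop :=
  exists2 B : set C, bounded_set B & A `<=` [set (Some z : S) | z in B].

Definition component_of A K : Prop :=
  exists2 z, A z & K = connected_component A z.

Definition multiply_connected U : Prop :=
  exists K1 K2, [/\ component_of (~` U) K1, component_of (~` U) K2 & K1 <> K2].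

Definition surrounds A B : Prop :=
  exists K, [/\ component_of (~` A) K, sphere_bounded K & B `<=` K].

Definition cdist A (w : C) : R :=
  inf [set modulus (z - w) | z in [set z : C | A (Some z)]].

(* Every sequence in the family F has a subsequence that converges locally
   uniformly on U with respect to the chordal metric. *)
Definition normal_family U (F : set (S -> S)) : Prop :=
  forall u : nat -> S -> S, (forall n, F (u n)) ->
  exists phi : nat -> nat, {homo phi : m n / (m < n)%N} /\
  exists g : S -> S, forall z, U z -> exists2 V, nbhs z V &
    forall e : R, 0 < e -> \forall k \near \oo,
      forall w, (U `&` V) w -> chordal (u (phi k) w) (g w) < e.

End Sphere.

Section Meromorphic.
Variable R : realType.
Local Notation C := (Cplx R).
Local Notation S := (sphere R).
Implicit Type f : C -> S.

(* Either f is finite and holomorphic near z, or z is a pole of f. *)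
Definition meromorphic_at f (z : C) : Prop :=
  (exists g : C -> C, \forall w \near z,
     f w = Some (g w) /\ derivable g w 1) \/
  [/\ f z = None,
      exists g : C -> C, \forall w \near z^',
        f w = Some (g w) /\ derivable g w 1 &
      f w @[w --> z^'] --> (None : S)].

(* The second conjunct: infinity is an essential singularity, i.e. no value l
   at infinity makes f meromorphic there, in the coordinate w = 1/z. *)
Definition transcendental_meromorphic f : Prop :=
  (forall z, meromorphic_at f z) /\
  ~ exists l : S, meromorphic_at (fun w => if w == 0 then l else f w^-1) 0.

(* The value at infinity is a dummy, which [iter_defined] excludes. *)
Definition extend f (z : S) : S := if z is Some x then f x else None.

Definition iterate f (n : nat) : S -> S := iter n (extend f).

Definition iter_defined f (n : nat) (z : S) : Prop :=
  forall k, (k < n)%N -> iterate f k z <> None.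

Definition fatou_set f : set S :=
  [set z | exists U, [/\ open_nbhs z U,
     forall n w, U w -> iter_defined f n w &
     normal_family U (range (iterate f))]].

Definition fatou_component f (W : set S) : Prop := component_of (fatou_set f) W.

(* W_n: the Fatou component that contains f^n(W). *)
Definition image_component f (W : set S) (n : nat) : set S :=
  xget set0 [set V | fatou_component f V /\ iterate f n @` W `<=` V].

Definition wandering f (W : set S) : Prop :=
  fatou_component f W /\
  forall m n, m <> n -> image_component f W m `&` image_component f W n = set0.

Definition baker_wandering_domain f (W : set S) : Prop :=
  [/\ wandering f W,
      \forall n \near \oo,
        [/\ multiply_connected (image_component f W n),
            sphere_bounded (image_component f W n) &
            surrounds (image_component f W n) [set (Some 0 : S)]],
      cdist (image_component f W n) 0 @[n --> \oo] --> +oo &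
      forall z, W z -> iterate f n z @[n --> \oo] --> (None : S)].

Definition asymptotic_value f (a : S) : Prop :=
  exists gamma : R -> C,
    [/\ {within `[0, +oo[, continuous gamma},
        (Some (gamma t) : S) @[t --> +oo] --> (None : S) &
        f (gamma t) @[t --> +oo] --> a].

End Meromorphic.

(* Main.v *)
Require Import Defs.
From HB Require Import structures.
From mathcomp Require Import all_boot all_order all_algebra.
From mathcomp Require Import all_classical all_reals all_analysis.
From mathcomp Require Import ring lra.
Import Order.TTheory GRing.Theory Num.Theory.
Import numFieldNormedType.Exports.
Local Open Scope classical_set_scope.
Local Open Scope ring_scope.

(** Let W be a Baker wandering domain and gamma an unbounded curve. For large n
    the domain W_n surrounds 0 and lies outside any given disc around 0, in
    particular outside one that contains a point of gamma. The bounded component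
    of the complement of W_n that contains 0 contains that disc; since gamma is
    connected and unbounded it cannot stay in this component, so it meets W_n
    ([surrounds_meets]). Hence f(gamma) meets f(W_n), which is contained in
    W_{n+1} ([baker_image]), and dist(W_{n+1}, 0) tends to infinity: f(gamma) is
    unbounded. If f had a finite asymptotic value, a tail of the asymptotic curve
    would be an unbounded curve with bounded image.

    The inclusion of f(W_n) in W_{n+1} is where complex analysis enters. Both
    sets contain a point of the orbit of W, and W_n is connected, so it suffices
    that f maps Fatou points near which it is not constant to Fatou points
    ([fatou_image], [component_image]). This follows from the open mapping
    theorem, since normality on a neighbourhood of x then yields normality on a
    neighbourhood of f(x).

    The open mapping theorem ([open_mapping]) is derived here for functions that
    are merely complex differentiable near a point: the integral along the
    boundary of a rectangle vanishes by quadrisection ([Goursat]), also when one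
    interior point is excepted ([Goursat_except]); this gives the Cauchy formula
    ([Cauchy_formula]) up to a nonvanishing factor, and from it the isolation of
    zeros ([isolated_zeros]). *)

Set Implicit Arguments.
Unset Strict Implicit.
Unset Printing Implicit Defensive.

(** * Integrals of continuous real functions over segments *)

Section RealIntegral.
Variable R : realType.
Implicit Types (f g : R -> R) (a b c : R).
Local Notation mu := (@lebesgue_measure R).

Lemma continuous_integrable f a b : continuous f ->
  mu.-integrable `[a, b] (EFin \o f).
Proof.
move=> cf; apply: continuous_compact_integrable; first exact: segment_compact.
exact: continuous_subspaceT.
Qed.

Lemma Rintegral_cat f a b c : continuous f -> a <= b -> b <= c ->
  \int[mu]_(x in `[a, c]) f x =
  \int[mu]_(x in `[a, b]) f x + \int[mu]_(x in `[b, c]) f x.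
Proof.
move=> cf ab bc.
have := @Rintegral_itvB R f (BLeft a) (BRight c) b (@continuous_integrable f a c cf).
rewrite !bnd_simp => /(_ ab bc) H.
rewrite -(@Rintegral_itv_obnd_cbnd R b (BRight c)); last first.
  apply: (@integrableS _ _ _ mu `[b, c]) => //.
    exact: subset_itv_oc_cc.
  exact: continuous_integrable.
by rewrite -H addrC subrK.
Qed.

Lemma Rintegral_const a b c : a <= b -> \int[mu]_(x in `[a, b]) c = c * (b - a).
Proof.
move=> ab; rewrite Rintegral_cst//= lebesgue_measure_itv/= lte_fin.
case: ltP => // ba; have -> : a = b by apply/eqP; rewrite eq_le ab.
by rewrite subrr.
Qed.

Lemma Rintegral_le_const f a b c : continuous f -> a <= b ->
  (forall x, a <= x <= b -> f x <= c) ->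
  \int[mu]_(x in `[a, b]) f x <= c * (b - a).
Proof.
move=> cf ab fc; rewrite -Rintegral_const//; apply: le_Rintegral => //.
- exact: continuous_integrable.
- apply: continuous_integrable; exact: cst_continuous.
Qed.

Lemma Rintegral_ge_const f a b c : continuous f -> a <= b ->
  (forall x, a <= x <= b -> c <= f x) ->
  c * (b - a) <= \int[mu]_(x in `[a, b]) f x.
Proof.
move=> cf ab fc; rewrite -Rintegral_const//; apply: le_Rintegral => //.
- apply: continuous_integrable; exact: cst_continuous.
- exact: continuous_integrable.
Qed.

End RealIntegral.

(** * The modulus and the topology of the complex plane *)

Section Modulus.
Local Open Scope complex_scope.
Variable R : realType.
Local Notation C := (Cplx R).
Local Notation re := complex.Re.
Local Notation im := complex.Im.
Implicit Types z w : C.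

Lemma complex_ext z w : re z = re w -> im z = im w -> z = w.
Proof. by case: z => a b; case: w => c d /= -> ->. Qed.

Lemma modulus_ge0 z : 0 <= modulus z.
Proof. by case: z => x y; exact: sqrtr_ge0. Qed.

Lemma modulus0 : modulus (0 : C) = 0.
Proof. exact: Normc.normc0. Qed.

Lemma modulus_eq0 z : modulus z = 0 -> z = 0.
Proof. exact: Normc.eq0_normc. Qed.

Lemma modulus_gt0 z : z != 0 -> 0 < modulus z.
Proof.
move=> z0; rewrite lt_neqAle modulus_ge0 andbT eq_sym.
by apply: contra z0 => /eqP/modulus_eq0 ->.
Qed.

Lemma modulusM z w : modulus (z * w) = modulus z * modulus w.
Proof. exact: Normc.normcM. Qed.

Lemma modulusV z : modulus z^-1 = (modulus z)^-1.
Proof. exact: Normc.normcV. Qed.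

Lemma modulusX z n : modulus (z ^+ n) = modulus z ^+ n.
Proof.
elim: n => [|n IH]; first exact: Normc.normc1.
by rewrite !exprS modulusM IH.
Qed.

Lemma modulusN z : modulus (- z) = modulus z.
Proof. exact: normcN. Qed.

Lemma modulusD z w : modulus (z + w) <= modulus z + modulus w.
Proof. exact: le_normcD. Qed.

Lemma modulusB z w : modulus (z - w) <= modulus z + modulus w.
Proof. by rewrite -(modulusN w); exact: modulusD. Qed.

Lemma modulus_sym z w : modulus (z - w) = modulus (w - z).
Proof. by rewrite -modulusN opprB. Qed.

Lemma modulus_dist z w : modulus z - modulus w <= modulus (z - w).
Proof. by rewrite lerBlDr (le_trans _ (modulusD _ _))// subrK. Qed.

Lemma modulus_real (x : R) : modulus (x%:C : C) = `|x|.
Proof. by rewrite /modulus/= expr0n/= addr0 sqrtr_sqr. Qed.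

Lemma modulus_imag (x : R) : modulus (0 +i* x : C) = `|x|.
Proof. by rewrite /modulus/= expr0n/= add0r sqrtr_sqr. Qed.

Lemma Re_le_modulus z : `|re z| <= modulus z.
Proof.
case: z => x y /=; rewrite -sqrtr_sqr ler_wsqrtr// lerDl; exact: sqr_ge0.
Qed.

Lemma Im_le_modulus z : `|im z| <= modulus z.
Proof.
case: z => x y /=; rewrite -sqrtr_sqr ler_wsqrtr// lerDr; exact: sqr_ge0.
Qed.

Lemma modulus_le_ReIm z : modulus z <= `|re z| + `|im z|.
Proof.
case: z => x y; have {1}-> : x +i* y = (x%:C : C) + (0 +i* y) :> C by simpc.
by rewrite (le_trans (modulusD _ _))// modulus_real modulus_imag.
Qed.

Lemma normC_modulus z : `|z| = (modulus z)%:C.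
Proof. by case: z. Qed.

(** The norm of [R[i]] takes its values in [R[i]]; this restates the
    neighbourhoods of the plane with radii in [R]. *)
Lemma nbhsCP z (P : set C) :
  nbhs z P <-> exists2 e : R, 0 < e & forall w, modulus (w - z) < e -> P w.
Proof.
split=> [/nbhs_ballP[/= e e0 zP]|[e e0 zP]].
  have e_re : e = (re e)%:C by rewrite RRe_real// gtr0_real.
  exists (re e); first by rewrite -ltcR -e_re.
  move=> w we; apply: zP; rewrite -ball_normE/= normC_modulus e_re ltcR.
  by rewrite modulus_sym.
apply/nbhs_ballP; exists e%:C => /=; first by rewrite ltcR.
move=> w; rewrite -ball_normE/= normC_modulus ltcR => we; apply: zP.
by rewrite modulus_sym.
Qed.

Lemma cvgCP {T} (F : set_system T) {FF : Filter F} (f : T -> C) (l : C) :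
  f @ F --> l <->
  forall e : R, 0 < e -> \forall t \near F, modulus (f t - l) < e.
Proof.
split=> [fl e e0|fl P /nbhsCP[e e0 eP]]; last first.
  by move: (fl e e0); apply: filterS => t /eP.
by apply: (fl [set w | modulus (w - l) < e]); apply/nbhsCP; exists e.
Qed.

Lemma cvgC_nbhsP (f : C -> C) (z l : C) :
  f @ z --> l <-> forall e : R, 0 < e -> exists2 d : R, 0 < d &
    forall w, modulus (w - z) < d -> modulus (f w - l) < e.
Proof.
split=> [/(@cvgCP C (nbhs z)) fl e /fl /nbhsCP//|fl].
by apply/(@cvgCP C (nbhs z)) => e e0; apply/nbhsCP; exact: fl.
Qed.

Lemma continuous_Re : continuous (fun z : C => re z : R).
Proof.
move=> z; apply/(@cvgrPdist_lt R R^o C (nbhs z)) => e e0; apply/nbhsCP; exists e => // w.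
apply: le_lt_trans; rewrite modulus_sym.
have -> : (re z - re w : R) = re (z - w) by case: z; case: w.
exact: Re_le_modulus.
Qed.

Lemma continuous_Im : continuous (fun z : C => im z : R).
Proof.
move=> z; apply/(@cvgrPdist_lt R R^o C (nbhs z)) => e e0; apply/nbhsCP; exists e => // w.
apply: le_lt_trans; rewrite modulus_sym.
have -> : (im z - im w : R) = im (z - w) by case: z; case: w.
exact: Im_le_modulus.
Qed.

Lemma cvg_complex {T} (F : set_system T) {FF : Filter F} (u v : T -> R) a b :
  u @ F --> a -> v @ F --> b -> (fun t => u t +i* v t : C) @ F --> (a +i* b : C).
Proof.
move=> /cvgrPdist_lt ua /cvgrPdist_lt vb; apply/cvgCP => e e0.
have e2 : 0 < e / 2 by rewrite divr_gt0.
near=> t; rewrite (le_lt_trans (modulus_le_ReIm _))//=.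
rewrite [ltRHS](splitr e) ltrD// distrC.
- by near: t; exact: ua.
- by near: t; exact: vb.
Unshelve. all: by end_near. Qed.

Lemma continuous_modulus : continuous (fun z : C => modulus z : R).
Proof.
move=> z; apply/(@cvgrPdist_lt R R^o C (nbhs z)) => e e0; apply/nbhsCP; exists e => // w.
apply: le_lt_trans; rewrite ler_norml lerNl opprB modulus_dist/=.
by rewrite modulus_sym modulus_dist.
Qed.

Lemma continuous_hline (c : R) : continuous (fun x : R => x +i* c : C).
Proof. by move=> x; apply: cvg_complex; [exact: cvg_id|exact: cvg_cst]. Qed.

Lemma continuous_vline (a : R) : continuous (fun y : R => a +i* y : C).
Proof. by move=> x; apply: cvg_complex; [exact: cvg_cst|exact: cvg_id]. Qed.

Section Algebra.
Context {T : Type} {F : set_system T} {FF : Filter F}.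
Implicit Types (f g : T -> C) (a b : C).

Lemma cvgCD f g a b : f @ F --> a -> g @ F --> b ->
  (fun t => f t + g t) @ F --> (a + b : C).
Proof. exact: cvgD. Qed.

Lemma cvgCB f g a b : f @ F --> a -> g @ F --> b ->
  (fun t => f t - g t) @ F --> (a - b : C).
Proof. exact: cvgB. Qed.

Lemma cvgCM f g a b : f @ F --> a -> g @ F --> b ->
  (fun t => f t * g t) @ F --> (a * b : C).
Proof. exact: (@cvgZ R[i] C T F FF f g a b). Qed.

Lemma cvgCV f a : a != 0 -> f @ F --> a -> (fun t => (f t)^-1) @ F --> (a^-1 : C).
Proof. by move=> a0 fa; exact: (@cvgV R[i] T F FF f a a0 fa). Qed.

End Algebra.

(** Instances of the algebraic limit laws at the neighbourhood filter of a
    point of the plane. *)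
Lemma cvgCM_at (f g : C -> C) (z a b : C) : f @ z --> a -> g @ z --> b ->
  (fun t => f t * g t) @ z --> (a * b : C).
Proof. exact: (@cvgCM C (nbhs z)). Qed.

Lemma cvgCD_at (f g : C -> C) (z a b : C) : f @ z --> a -> g @ z --> b ->
  (fun t => f t + g t) @ z --> (a + b : C).
Proof. exact: (@cvgCD C (nbhs z)). Qed.

Lemma cvgCV_at (f : C -> C) (z a : C) : a != 0 -> f @ z --> a ->
  (fun t => (f t)^-1) @ z --> (a^-1 : C).
Proof. exact: (@cvgCV C (nbhs z)). Qed.

Lemma cvgC_sub_at (f : C -> C) (z a k : C) : f @ z --> a ->
  (fun t => f t - k) @ z --> (a - k : C).
Proof.
by move=> fa; exact: (@cvgCB C (nbhs z) _ f (fun=> k) a k fa (@cvg_cst C k C (nbhs z) _)).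
Qed.

Lemma cvgC_id_at z : (fun t : C => t) @ z --> z.
Proof. exact: cvg_id. Qed.

Section ContinuousAlgebra.
Context {T : topologicalType}.
Implicit Types (f g : T -> C).

Lemma continuousCD f g : continuous f -> continuous g ->
  continuous (fun t => f t + g t).
Proof. by move=> cf cg t; apply: cvgCD; [exact: cf|exact: cg]. Qed.

Lemma continuousCB f g : continuous f -> continuous g ->
  continuous (fun t => f t - g t).
Proof. by move=> cf cg t; apply: cvgCB; [exact: cf|exact: cg]. Qed.

Lemma continuousCM f g : continuous f -> continuous g ->
  continuous (fun t => f t * g t).
Proof. by move=> cf cg t; apply: cvgCM; [exact: cf|exact: cg]. Qed.

Lemma continuousCV f : (forall t, f t != 0) -> continuous f ->
  continuous (fun t => (f t)^-1).
Proof. by move=> f0 cf t; apply: cvgCV; [exact: f0|exact: cf]. Qed.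

Lemma continuousCcst (l : C) : continuous (fun _ : T => l).
Proof. by move=> t; exact: cvg_cst. Qed.

End ContinuousAlgebra.

Lemma cvgC_cst_at (z k : C) : (fun _ : C => k) @ z --> k.
Proof. exact: (@continuousCcst C k z). Qed.

End Modulus.

(** * Integrals of complex-valued functions along the boundary of a rectangle *)

Section LineIntegral.
Local Open Scope complex_scope.
Variable R : realType.
Local Notation C := (Cplx R).
Local Notation re := complex.Re.
Local Notation im := complex.Im.
Local Notation mu := (@lebesgue_measure R).
Implicit Types (h k : R -> C) (f g : C -> C) (a b c d : R).

(** The integral over [a, b] of a complex-valued function of a real variable. *)
Definition cintegral h a b : C :=
  (\int[mu]_(x in `[a, b]) re (h x)) +i* (\int[mu]_(x in `[a, b]) im (h x)).

Lemma continuous_re_comp h : continuous h -> continuous (fun x => re (h x)).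
Proof. move=> ch x; apply: continuous_comp; [exact: ch|exact: continuous_Re]. Qed.

Lemma continuous_im_comp h : continuous h -> continuous (fun x => im (h x)).
Proof. move=> ch x; apply: continuous_comp; [exact: ch|exact: continuous_Im]. Qed.

Lemma eq_cintegral h k a b : (forall x, a <= x <= b -> h x = k x) ->
  cintegral h a b = cintegral k a b.
Proof.
move=> hk; congr (_ +i* _); apply: eq_Rintegral => x;
  by rewrite inE/= in_itv/= => /hk ->.
Qed.

Lemma cintegralD h k a b : continuous h -> continuous k ->
  cintegral (fun x => h x + k x) a b = cintegral h a b + cintegral k a b.
Proof.
move=> ch ck; rewrite /cintegral.
have -> : (fun x => re (h x + k x)) = (fun x => re (h x) + re (k x)).
  by apply/funext => x; case: (h x); case: (k x).
have -> : (fun x => im (h x + k x)) = (fun x => im (h x) + im (k x)).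
  by apply/funext => x; case: (h x); case: (k x).
by rewrite !RintegralD//; apply: continuous_integrable;
  do ?[exact: continuous_re_comp|exact: continuous_im_comp].
Qed.

Lemma cintegralZ (l : C) h a b : continuous h ->
  cintegral (fun x => l * h x) a b = l * cintegral h a b.
Proof.
case: l => u v ch; rewrite /cintegral.
have cr := continuous_re_comp ch; have ci := @continuous_im_comp _ ch.
have iZ (r : R) (p : R -> R) : continuous p ->
    mu.-integrable `[a, b] (EFin \o (fun x => r * p x)).
  move=> cp; apply: continuous_integrable => x.
  by apply: continuousM; [exact: cst_continuous|exact: cp].
have -> : (fun x => re ((u +i* v) * h x)) = (fun x => u * re (h x) - v * im (h x)).
  by apply/funext => x; case: (h x).
have -> : (fun x => im ((u +i* v) * h x)) = (fun x => u * im (h x) + v * re (h x)).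
  by apply/funext => x; case: (h x).
rewrite RintegralB// ?RintegralD//; do ?exact: iZ.
by rewrite !RintegralZl//; exact: continuous_integrable.
Qed.

Lemma cintegralB h k a b : continuous h -> continuous k ->
  cintegral (fun x => h x - k x) a b = cintegral h a b - cintegral k a b.
Proof.
move=> ch ck; have -> : (fun x => h x - k x) = (fun x => h x + (-1) * k x).
  by apply/funext => x; rewrite mulN1r.
rewrite cintegralD; last 2 first.
- exact: ch.
- by apply: continuousCM; [exact: continuousCcst|exact: ck].
by rewrite cintegralZ; [rewrite mulN1r|exact: ck].
Qed.

Lemma cintegral_cat h a b c : continuous h -> a <= b -> b <= c ->
  cintegral h a c = cintegral h a b + cintegral h b c.
Proof.
move=> ch ab bc; rewrite /cintegral.
rewrite (@Rintegral_cat R _ _ _ _ (continuous_re_comp ch) ab bc).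
by rewrite (@Rintegral_cat R _ _ _ _ (continuous_im_comp ch) ab bc).
Qed.

Lemma cintegral_const (l : C) a b : a <= b ->
  cintegral (fun=> l) a b = (b - a)%:C * l.
Proof.
case: l => u v ab; rewrite /cintegral !Rintegral_const//.
by apply: complex_ext => /=; ring.
Qed.

(** The factor 2 comes from bounding the real and imaginary parts separately;
    no sharper constant is needed. *)
Lemma cintegral_bound h a b (M : R) : continuous h -> a <= b ->
  (forall x, a <= x <= b -> modulus (h x) <= M) ->
  modulus (cintegral h a b) <= 2 * M * (b - a).
Proof.
move=> ch ab hM.
have bnd (p : R -> R) : continuous p -> (forall x, `|p x| <= modulus (h x)) ->
    `|\int[mu]_(x in `[a, b]) p x| <= M * (b - a).
  move=> cp pM; rewrite ler_norml -mulNr; apply/andP; split.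
    apply: Rintegral_ge_const => // x /hM xM.
    by have := le_trans (pM x) xM; rewrite ler_norml => /andP[].
  apply: Rintegral_le_const => // x /hM xM.
  by have := le_trans (pM x) xM; rewrite ler_norml => /andP[].
rewrite (le_trans (modulus_le_ReIm _))//= -mulrA mulr2n mulrDl !mul1r lerD//.
- apply: bnd; [exact: continuous_re_comp|move=> x; exact: Re_le_modulus].
- apply: bnd; [exact: continuous_im_comp|move=> x; exact: Im_le_modulus].
Qed.

(** The integral of [f dz] along the positively oriented boundary of the
    rectangle with sides on x = a, x = b, y = c and y = d. *)
Definition rect_integral f a b c d : C :=
  cintegral (fun x => f (x +i* c)) a b - cintegral (fun x => f (x +i* d)) a b +
  'i * (cintegral (fun y => f (b +i* y)) c d -
        cintegral (fun y => f (a +i* y)) c d).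

(** [f] is continuous along each of the four lines that carry the sides of the
    rectangle. The lines are taken whole, rather than the sides, so that this
    is plain continuity of functions of one real variable. *)
Definition side_continuous f a b c d :=
  [/\ continuous (fun x => f (x +i* c)), continuous (fun x => f (x +i* d)),
      continuous (fun y => f (b +i* y)) & continuous (fun y => f (a +i* y))].

(** [z] lies on the boundary of the rectangle. *)
Definition on_sides a b c d (z : C) :=
  (a <= re z <= b) && ((im z == c) || (im z == d)) ||
  (c <= im z <= d) && ((re z == a) || (re z == b)).

Lemma side_continuousT f a b c d : continuous f -> side_continuous f a b c d.
Proof.
move=> cf; split => x.
- exact: (continuous_comp (@continuous_hline R c x) (cf _)).
- exact: (continuous_comp (@continuous_hline R d x) (cf _)).
- exact: (continuous_comp (@continuous_vline R b x) (cf _)).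
- exact: (continuous_comp (@continuous_vline R a x) (cf _)).
Qed.

Lemma eq_rect_integral f g a b c d :
  (forall z, on_sides a b c d z -> f z = g z) ->
  rect_integral f a b c d = rect_integral g a b c d.
Proof.
move=> fg; rewrite /rect_integral; congr (_ - _ + _ * (_ - _));
  apply: eq_cintegral => x xI; apply: fg; rewrite /on_sides/= xI eqxx ?orbT//.
Qed.

Lemma rect_integralD f g a b c d :
  side_continuous f a b c d -> side_continuous g a b c d ->
  rect_integral (fun z => f z + g z) a b c d =
  rect_integral f a b c d + rect_integral g a b c d.
Proof.
move=> [f1 f2 f3 f4] [g1 g2 g3 g4]; rewrite /rect_integral.
rewrite (cintegralD a b f1 g1) (cintegralD a b f2 g2).
by rewrite (cintegralD c d f3 g3) (cintegralD c d f4 g4); ring.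
Qed.

Lemma rect_integralB f g a b c d :
  side_continuous f a b c d -> side_continuous g a b c d ->
  rect_integral (fun z => f z - g z) a b c d =
  rect_integral f a b c d - rect_integral g a b c d.
Proof.
move=> [f1 f2 f3 f4] [g1 g2 g3 g4]; rewrite /rect_integral.
rewrite (cintegralB a b f1 g1) (cintegralB a b f2 g2).
by rewrite (cintegralB c d f3 g3) (cintegralB c d f4 g4); ring.
Qed.

Lemma rect_integralZ (l : C) f a b c d : side_continuous f a b c d ->
  rect_integral (fun z => l * f z) a b c d = l * rect_integral f a b c d.
Proof.
move=> [f1 f2 f3 f4]; rewrite /rect_integral.
rewrite (cintegralZ l a b f1) (cintegralZ l a b f2).
by rewrite (cintegralZ l c d f3) (cintegralZ l c d f4); ring.
Qed.

Lemma rect_integral_const (l : C) a b c d : a <= b -> c <= d ->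
  rect_integral (fun=> l) a b c d = 0.
Proof. by move=> ab cd; rewrite /rect_integral !subrr mulr0 addr0. Qed.

Lemma rect_integral_id a b c d : a <= b -> c <= d ->
  rect_integral id a b c d = 0.
Proof.
move=> ab cd; rewrite /rect_integral.
rewrite -(cintegralB a b (@continuous_hline R c) (@continuous_hline R d)).
rewrite -(cintegralB c d (@continuous_vline R b) (@continuous_vline R a)).
rewrite (@eq_cintegral _ (fun=> 0 +i* (c - d))); last first.
  by move=> x _; apply: complex_ext => /=; ring.
rewrite (@eq_cintegral (fun _ => _ - _) (fun=> (b - a)%:C)); last first.
  by move=> x _; apply: complex_ext => /=; ring.
by rewrite !cintegral_const//; apply: complex_ext => /=; ring.
Qed.

Lemma rect_integral_split_x f a m b c d : continuous f ->
  a <= m -> m <= b ->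
  rect_integral f a b c d = rect_integral f a m c d + rect_integral f m b c d.
Proof.
move=> cf am mb; have [f1 f2 _ _] := side_continuousT a b c d cf.
by rewrite /rect_integral (cintegral_cat f1 am mb) (cintegral_cat f2 am mb); ring.
Qed.

Lemma rect_integral_split_y f a b c m d : continuous f ->
  c <= m -> m <= d ->
  rect_integral f a b c d = rect_integral f a b c m + rect_integral f a b m d.
Proof.
move=> cf am mb; have [_ _ f3 f4] := side_continuousT a b c d cf.
by rewrite /rect_integral (cintegral_cat f3 am mb) (cintegral_cat f4 am mb); ring.
Qed.

Lemma rect_integral_bound f a b c d M : side_continuous f a b c d ->
  a <= b -> c <= d -> (forall z, on_sides a b c d z -> modulus (f z) <= M) ->
  modulus (rect_integral f a b c d) <= 4 * M * ((b - a) + (d - c)).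
Proof.
move=> [f1 f2 f3 f4] ab cd fM.
have h1 : modulus (cintegral (fun x => f (x +i* c)) a b) <= 2 * M * (b - a).
  by apply: (cintegral_bound f1) => // x xI; apply: fM; rewrite /on_sides/= xI eqxx.
have h2 : modulus (cintegral (fun x => f (x +i* d)) a b) <= 2 * M * (b - a).
  by apply: (cintegral_bound f2) => // x xI; apply: fM; rewrite /on_sides/= xI eqxx orbT.
have h3 : modulus (cintegral (fun y => f (b +i* y)) c d) <= 2 * M * (d - c).
  by apply: (cintegral_bound f3) => // x xI; apply: fM; rewrite /on_sides/= xI eqxx !orbT.
have h4 : modulus (cintegral (fun y => f (a +i* y)) c d) <= 2 * M * (d - c).
  by apply: (cintegral_bound f4) => // x xI; apply: fM; rewrite /on_sides/= xI eqxx !orbT.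
have i1 : modulus ('i : C) = 1 by rewrite (modulus_imag (1:R)) normr1.
rewrite (le_trans (modulusD _ _))// modulusM i1 mul1r.
have := modulusB (cintegral (fun x => f (x +i* c)) a b) (cintegral (fun x => f (x +i* d)) a b).
have := modulusB (cintegral (fun y => f (b +i* y)) c d) (cintegral (fun y => f (a +i* y)) c d).
by lra.
Qed.

End LineIntegral.

(** * The theorem of Goursat *)

Section Goursat.
Local Open Scope complex_scope.
Variable R : realType.
Local Notation C := (Cplx R).
Local Notation re := complex.Re.
Local Notation im := complex.Im.
Implicit Types (f g : C -> C) (a b c d : R) (z w l : C).

Lemma nested_intervals (a b : nat -> R) :
  (forall n, a n <= a n.+1) -> (forall n, b n.+1 <= b n) ->
  (forall n, a n <= b n) -> exists x, forall n, a n <= x <= b n.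
Proof.
move=> a_incr b_decr ab.
have amono : {homo a : m n / (m <= n)%N >-> m <= n} by exact: homo_leq le_trans a_incr.
have bmono : {homo b : m n / (m <= n)%N >-> n <= m}.
  by apply: (homo_leq (r := fun x y => y <= x)) => // x y z xy yz; exact: le_trans yz xy.
have ub n : ubound (range a) (b n).
  move=> _ [m _ <-]; rewrite (le_trans (amono _ _ (leq_maxl m n)))//.
  by rewrite (le_trans (ab _))// bmono// leq_maxr.
have ne : range a !=set0 by exists (a 0%N), 0%N.
exists (sup (range a)) => n; apply/andP; split.
  by apply: ub_le_sup; [exists (b 0%N); exact: ub|exists n].
by apply: ge_sup => //; exact: ub.
Qed.

Lemma exists_expn_gt (x d : R) : 0 < d -> exists n, x < d * 2 ^+ n.
Proof.
move=> d0; exists (Num.bound `|x / d|).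
rewrite mulrC -ltr_pdivrMr// (le_lt_trans (ler_norm _))//.
rewrite (lt_le_trans (archi_boundP (normr_ge0 _)))//.
by rewrite -natrX ler_nat ltnW// ltn_expl.
Qed.

(** [l] is the complex derivative of [f] at [z], in terms of the real-valued
    modulus. *)
Definition cderiv f z l := forall e : R, 0 < e -> exists2 d : R, 0 < d &
  forall w, modulus (w - z) < d ->
    modulus (f w - f z - l * (w - z)) <= e * modulus (w - z).

Definition cdifferentiable f z := exists l, cderiv f z l.

(** [z] lies in the closed rectangle. *)
Definition in_rect a b c d z := (a <= re z <= b) && (c <= im z <= d).

Lemma on_sides_in_rect a b c d z : a <= b -> c <= d ->
  on_sides a b c d z -> in_rect a b c d z.
Proof.
move=> ab cd; rewrite /on_sides /in_rect.
by case/orP => /andP[-> /orP[]/eqP->]; rewrite lexx ?ab ?cd.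
Qed.

Lemma continuousCid : continuous (fun w : C => w).
Proof. by move=> w; exact: cvg_id. Qed.

Lemma continuous_affine (k l : C) : continuous (fun w : C => k + l * w).
Proof.
exact: (continuousCD (@continuousCcst R C k)
  (continuousCM (@continuousCcst R C l) continuousCid)).
Qed.

(** Affine functions have vanishing boundary integrals: the only instance of
    the theorem of Cauchy that has to be computed by hand. *)
Lemma rect_integral_sub_affine f (k l : C) a b c d : continuous f ->
  a <= b -> c <= d ->
  rect_integral (fun w => f w - (k + l * w)) a b c d = rect_integral f a b c d.
Proof.
move=> cf ab cd.
have ck : continuous (fun w : C => k) := @continuousCcst R C k.
have cl : continuous (fun w : C => l * w).
  exact: (continuousCM (@continuousCcst R C l) continuousCid).
have ckl := @continuous_affine k l.
have sc g : continuous g -> side_continuous g a b c d.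
  exact: side_continuousT.
rewrite (rect_integralB (sc _ cf) (sc _ ckl)).
rewrite (rect_integralD (sc _ ck) (sc _ cl)) (rect_integralZ l (sc _ continuousCid)).
by rewrite rect_integral_const// rect_integral_id// mulr0 addr0 subr0.
Qed.

(** A rectangle ((a, b), (c, d)) with sides [a, b] and [c, d]. *)
Let rect := ((R * R) * (R * R))%type.
Let rI f (p : rect) := rect_integral f p.1.1 p.1.2 p.2.1 p.2.2.
Let valid (p : rect) := (p.1.1 <= p.1.2) && (p.2.1 <= p.2.2).

(** [q] is a rectangle of half the size inside [p] that carries at least a
    quarter of the boundary integral over [p]. *)
Let quarter f (p q : rect) := [/\ valid q,
  (p.1.1 <= q.1.1) && (q.1.2 <= p.1.2), (p.2.1 <= q.2.1) && (q.2.2 <= p.2.2),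
  (q.1.2 - q.1.1 + (q.2.2 - q.2.1)) * 2 = p.1.2 - p.1.1 + (p.2.2 - p.2.1) &
  modulus (rI f p) <= 4 * modulus (rI f q)].

Let lt_four_quarters (t t1 t2 t3 t4 : R) : t <= t1 + t2 + (t3 + t4) ->
  4 * t1 < t -> 4 * t2 < t -> 4 * t3 < t -> 4 * t4 < t -> False.
Proof. lra. Qed.

Let exists_quarter f p : continuous f -> valid p -> exists q, quarter f p q.
Proof.
move: p => [[a b] [c d]] cf /andP[/= ab cd].
pose m := (a + b) / 2; pose n := (c + d) / 2.
have [am mb] : a <= m /\ m <= b by rewrite /m; lra.
have [cn nd] : c <= n /\ n <= d by rewrite /n; lra.
have := rect_integral_split_y a b cf cn nd.
rewrite (rect_integral_split_x c n cf am mb) (rect_integral_split_x n d cf am mb).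
set I1 := rect_integral f a m c n; set I2 := rect_integral f m b c n.
set I3 := rect_integral f a m n d; set I4 := rect_integral f m b n d.
set I := rect_integral _ _ _ _ _ => IE.
have Ile : modulus I <= modulus I1 + modulus I2 + (modulus I3 + modulus I4).
  by rewrite IE (le_trans (modulusD _ _))// lerD// modulusD.
have [h1|h1] := leP (modulus I) (4 * modulus I1).
  exists ((a, m), (c, n)); split; rewrite /valid/= ?lexx ?am ?mb ?cn ?nd//.
  by rewrite /m /n; field.
have [h2|h2] := leP (modulus I) (4 * modulus I2).
  exists ((m, b), (c, n)); split; rewrite /valid/= ?lexx ?am ?mb ?cn ?nd//.
  by rewrite /m /n; field.
have [h3|h3] := leP (modulus I) (4 * modulus I3).
  exists ((a, m), (n, d)); split; rewrite /valid/= ?lexx ?am ?mb ?cn ?nd//.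
  by rewrite /m /n; field.
have [h4|h4] := leP (modulus I) (4 * modulus I4).
  exists ((m, b), (n, d)); split; rewrite /valid/= ?lexx ?am ?mb ?cn ?nd//.
  by rewrite /m /n; field.
exfalso; exact: lt_four_quarters Ile h1 h2 h3 h4.
Qed.

(** The integral over the boundary is concentrated by quadrisection at a point,
    where [f] is affine up to an error that is small against the size of the
    rectangle; continuity of the derivative is not required. *)
Lemma Goursat f a b c d : continuous f -> a <= b -> c <= d ->
  (forall z, in_rect a b c d z -> cdifferentiable f z) ->
  rect_integral f a b c d = 0.
Proof.
move=> cf ab cd df.
have /choice[step stepP] : forall p, exists q, valid p -> quarter f p q.
  move=> p; have [vp|] := boolP (valid p); last by exists p.
  by have [q pq] := exists_quarter cf vp; exists q.
pose r n := iter n step ((a, b), (c, d)).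
have rv n : valid (r n).
  elim: n => [|n IH]; first by rewrite /valid/= ab cd.
  by have [] := stepP _ IH.
have rq n : quarter f (r n) (r n.+1) by exact: stepP.
pose S := b - a + (d - c) + 1.
have S0 : 0 < S by rewrite /S; lra.
have sz n : ((r n).1.2 - (r n).1.1 + ((r n).2.2 - (r n).2.1)) * 2 ^+ n = S - 1.
  elim: n => [|n <-]; first by rewrite /= /S; ring.
  by have [_ _ _ <- _] := rq n; rewrite exprSr; ring.
have rI0 n : modulus (rect_integral f a b c d) <= 4 ^+ n * modulus (rI f (r n)).
  elim: n => [|n IH]; first by rewrite expr0 mul1r.
  rewrite (le_trans IH)// exprSr -mulrA ler_pM2l ?exprn_gt0//.
  by have [] := rq n.
have [x xP] : exists x, forall n, (r n).1.1 <= x <= (r n).1.2.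
  apply: nested_intervals => n; try by have [_ /andP[]] := rq n.
  by have /andP[] := rv n.
have [y yP] : exists y, forall n, (r n).2.1 <= y <= (r n).2.2.
  apply: nested_intervals => n; try by have [_ _ /andP[]] := rq n.
  by have /andP[] := rv n.
have [l lP] : cdifferentiable f (x +i* y).
  by apply: df; rewrite /in_rect/= (xP 0%N) (yP 0%N).
set A := modulus (rect_integral f a b c d).
apply: modulus_eq0; rewrite -/A; apply/eqP; rewrite eq_le modulus_ge0 andbT.
rewrite leNgt; apply/negP => A0.
(* With this precision the n-th rectangle, of half-perimeter at most S / 2^n,
   has an integral of at most A / (2 * 4^n), against the lower bound A / 4^n. *)
have e0 : 0 < A / (8 * S ^+ 2) by rewrite divr_gt0// mulr_gt0// exprn_gt0.
have [del del0 delP] := lP _ e0.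
have [n nP] := exists_expn_gt S del0.
have n20 : 0 < 2 ^+ n :> R by rewrite exprn_gt0.
pose L := S / 2 ^+ n.
have Ld : L < del by rewrite /L ltr_pdivrMr.
have szL : (r n).1.2 - (r n).1.1 + ((r n).2.2 - (r n).2.1) <= L.
  by rewrite /L ler_pdivlMr// sz; lra.
have /andP[v1 v2] := rv n.
have L0 : 0 < L by rewrite /L divr_gt0.
pose e := A / (8 * S ^+ 2).
have bnd : modulus (rI f (r n)) <= 4 * (e * L) * L.
  rewrite /rI -(rect_integral_sub_affine (f (x +i* y) - l * (x +i* y)) l)//.
  apply: (@le_trans _ _ (4 * (e * L) *
      ((r n).1.2 - (r n).1.1 + ((r n).2.2 - (r n).2.1)))); last first.
    by rewrite ler_wpM2l// mulr_ge0// mulr_ge0 ?(ltW L0)// ltW.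
  apply: rect_integral_bound => //.
    apply: side_continuousT.
    exact: (continuousCB cf (@continuous_affine _ _)).
  move=> w /(on_sides_in_rect v1 v2)/andP[/andP[w1 w2] /andP[w3 w4]].
  have wL : modulus (w - (x +i* y)) <= L.
    rewrite (le_trans (modulus_le_ReIm _))// (le_trans _ szL)//.
    have := xP n; have := yP n => /andP[y1 y2] /andP[x1 x2].
    case: w w1 w2 w3 w4 => u v /= w1 w2 w3 w4.
    by apply: lerD; rewrite ler_norml; apply/andP; split;
      move: x1 x2 y1 y2 w1 w2 w3 w4; clear => *; lra.
  have := delP _ (le_lt_trans wL Ld).
  have -> : f w - f (x +i* y) - l * (w - (x +i* y)) =
     f w - (f (x +i* y) - l * (x +i* y) + l * w) by ring.
  by move=> /le_trans; apply; rewrite ler_wpM2l// ltW.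
have := le_trans (rI0 n) (ler_wpM2l (exprn_ge0 n (ler0n R 4)) bnd).
rewrite -/A; have -> : 4 ^+ n * (4 * (e * L) * L) = A / 2.
  have -> : 4 ^+ n = 2 ^+ n * 2 ^+ n :> R by rewrite -exprMn; congr (_ ^+ _); ring.
  by rewrite /e /L; field; rewrite !gt_eqF.
by lra.
Qed.

End Goursat.

(** * Complex differentiability *)

Section Differentiability.
Local Open Scope complex_scope.
Variable R : realType.
Local Notation C := (Cplx R).
Implicit Types (f g q : C -> C) (z w l : C).

Lemma modulusBxx z : modulus (z - z) = 0.
Proof. by rewrite subrr modulus0. Qed.

Lemma subC_neq0 z w : w != z -> w - z != 0 :> C.
Proof. by rewrite subr_eq0. Qed.

Lemma near_neqC z w : z != w -> \forall u \near z, u != w.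
Proof.
move=> zw; apply/nbhsCP; exists (modulus (z - w)).
  by apply: modulus_gt0; exact: subC_neq0.
by move=> u; apply: contraTneq => ->; rewrite modulus_sym ltxx.
Qed.

(** Caratheodory's form of differentiability: the difference quotient extends
    to a function that is continuous at [z]. *)
Lemma cdifferentiable_slope f z : cdifferentiable f z -> exists q : C -> C,
  [/\ q @ z --> q z, forall w, f w - f z = q w * (w - z) &
      forall w, w != z -> q w = (f w - f z) / (w - z)].
Proof.
move=> [l lP]; pose q w := if w == z then l else (f w - f z) / (w - z).
exists q; split => [|w|w wz]; last by rewrite /q (negbTE wz).
- apply/cvgC_nbhsP => e e0; have e2 : 0 < e / 2 by rewrite divr_gt0.
  have [d d0 dP] := lP _ e2; exists d => // w /dP wd.
  rewrite /q eqxx; case: eqVneq => [_|wz]; first by rewrite modulusBxx.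
  have wz0 := subC_neq0 wz.
  have -> : (f w - f z) / (w - z) - l = (f w - f z - l * (w - z)) / (w - z).
    by field.
  rewrite modulusM modulusV ltr_pdivrMr ?modulus_gt0// (le_lt_trans wd)//.
  by rewrite ltr_pM2r ?modulus_gt0// ltr_pdivrMr//; lra.
- rewrite /q; case: eqVneq => [->|wz]; first by rewrite !subrr mulr0.
  by rewrite divfK// subC_neq0.
Qed.

Lemma slope_cdifferentiable f q z : q @ z --> q z ->
  (\forall w \near z, f w - f z = q w * (w - z)) -> cdifferentiable f z.
Proof.
move=> /cvgC_nbhsP qz /nbhsCP[d1 d10 fq]; exists (q z) => e e0.
have [d2 d20 qe] := qz _ e0.
exists (Num.min d1 d2); first by rewrite lt_min d10.
move=> w; rewrite lt_min => /andP[/fq -> /qe/ltW we].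
by rewrite -mulrBl modulusM ler_wpM2r// modulus_ge0.
Qed.

Lemma cdifferentiable_continuous f z : cdifferentiable f z -> f @ z --> f z.
Proof.
move=> /cdifferentiable_slope[q [qz fq _]].
have qf : (fun w => f z + q w * (w - z)) @ z --> f z + q z * (z - z).
  apply: cvgCD_at; first exact: cvgC_cst_at.
  exact: (cvgCM_at qz (cvgC_sub_at (@cvgC_id_at R _))).
have fE : (fun w => f z + q w * (w - z)) = f.
  by apply/funext => w; rewrite -fq addrC subrK.
by rewrite fE subrr mulr0 addr0 in qf.
Qed.

Lemma near_cdifferentiable f g z : (\forall w \near z, f w = g w) ->
  cdifferentiable f z -> cdifferentiable g z.
Proof.
move=> fg /cdifferentiable_slope[q [qz fq _]].
apply: (slope_cdifferentiable qz).
have fgz := nbhs_singleton fg.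
by apply: filterS fg => w <-; rewrite -fgz.
Qed.

Lemma cdifferentiable_div f (k : C) z w : z != w -> cdifferentiable f z ->
  cdifferentiable (fun u => (f u - k) / (u - w)) z.
Proof.
move=> zw /cdifferentiable_slope[q [qz fq _]].
have zw0 := subC_neq0 zw.
apply: (@slope_cdifferentiable _ (fun u => (q u - (f z - k) / (z - w)) / (u - w))).
  exact: (cvgCM_at (cvgC_sub_at qz) (cvgCV_at zw0 (cvgC_sub_at (@cvgC_id_at R _)))).
apply: filterS (near_neqC zw) => u uw; have uw0 := subC_neq0 uw.
have -> : f u = f z + q u * (u - z) by rewrite -fq addrC subrK.
by field; rewrite uw0 zw0.
Qed.

Lemma cdifferentiable_inv f (k : C) z : f z != k -> cdifferentiable f z ->
  cdifferentiable (fun u => (f u - k)^-1) z.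
Proof.
move=> fk df; have cf := cdifferentiable_continuous df.
move: df => /cdifferentiable_slope[q [qz fq _]].
have fk0 := subC_neq0 fk.
apply: (@slope_cdifferentiable _ (fun u => - q u / ((f u - k) * (f z - k)))).
  apply: cvgCM_at; first exact: (cvgN qz).
  apply: cvgCV_at; first by rewrite mulf_neq0.
  exact: (cvgCM_at (@cvgC_sub_at R f z _ k cf) (@cvgC_cst_at R z (f z - k))).
have nk : \forall u \near z, f u != k := cf _ (near_neqC fk).
apply: filterS nk => u uk.
have uk0 := subC_neq0 uk.
have fuE : f u = f z + q u * (u - z) by rewrite -fq addrC subrK.
have -> : (f u - k)^-1 - (f z - k)^-1 = - (f u - f z) / ((f u - k) * (f z - k)).
  by field; rewrite fk0 uk0.
by rewrite fq; ring.
Qed.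

End Differentiability.

(** * The Cauchy integral formula for rectangles *)

Section Cauchy.
Local Open Scope complex_scope.
Variable R : realType.
Local Notation C := (Cplx R).
Local Notation re := complex.Re.
Local Notation im := complex.Im.
Implicit Types (f g : C -> C) (a b c d : R) (z w p : C).

(** [z] lies in the open rectangle. *)
Definition in_open_rect a b c d z := (a < re z < b) && (c < im z < d).

Lemma in_open_rectW a b c d z : in_open_rect a b c d z -> in_rect a b c d z.
Proof.
by move=> /andP[/andP[/ltW h1 /ltW h2] /andP[/ltW h3 /ltW h4]]; rewrite /in_rect h1 h2 h3.
Qed.

Lemma modulus_in_box p (h : R) z : re p - h <= re z <= re p + h ->
  im p - h <= im z <= im p + h -> modulus (z - p) <= h + h.
Proof.
move=> /andP[r1 r2] /andP[r3 r4]; rewrite (le_trans (modulus_le_ReIm _))//.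
case: z p r1 r2 r3 r4 => u v [s t] /= r1 r2 r3 r4.
by apply: lerD; rewrite ler_norml; apply/andP; split;
  move: r1 r2 r3 r4; clear => *; lra.
Qed.

(** Goursat with one interior point at which [f] is only continuous: away from
    a small square around [p] the integral vanishes, and over that square it
    is at most a constant times its side. *)
Lemma Goursat_except f a b c d p : continuous f -> in_open_rect a b c d p ->
  (forall z, in_rect a b c d z -> z != p -> cdifferentiable f z) ->
  rect_integral f a b c d = 0.
Proof.
move=> cf /andP[/andP[ap pb] /andP[cp pd]] df.
apply: modulus_eq0; apply/eqP; rewrite eq_le modulus_ge0 andbT leNgt.
apply/negP => A0; set A := modulus _ in A0.
have /cvgC_nbhsP/(_ 1 ltr01)[del del0 delP] := cf p.
pose M := modulus (f p) + 1.
have M0 : 0 < M by rewrite ltr_pwDr// modulus_ge0.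
pose h := Num.min (Num.min (Num.min (re p - a) (b - re p))
   (Num.min (im p - c) (d - im p))) (Num.min (del / 5) (A / (32 * M))).
have : h <= h by []; rewrite {2}/h !le_min.
move=> /andP[/andP[/andP[h1 h2] /andP[h3 h4]] /andP[h5 h6]].
have h0 : 0 < h by rewrite /h !lt_min !subr_gt0 ap pb cp pd !divr_gt0// mulr_gt0.
pose x1 := re p - h; pose x2 := re p + h.
pose y1 := im p - h; pose y2 := im p + h.
have [ax1 x12 x2b] : [/\ a <= x1, x1 <= x2 & x2 <= b].
  by move: h0 h1 h2; rewrite /x1 /x2; clear => *; split; lra.
have [cy1 y12 y2d] : [/\ c <= y1, y1 <= y2 & y2 <= d].
  by move: h0 h3 h4; rewrite /y1 /y2; clear => *; split; lra.
have zero a' b' c' d' : a <= a' -> a' <= b' -> b' <= b -> c <= c' -> c' <= d' ->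
    d' <= d -> ~~ in_rect a' b' c' d' p -> rect_integral f a' b' c' d' = 0.
  move=> aa' a'b' b'b cc' c'd' d'd pN; apply: Goursat => // z zr.
  apply: df; last by apply: contra pN => /eqP <-.
  move: zr => /andP[/andP[r1 r2] /andP[r3 r4]]; apply/andP; split; apply/andP; split.
  - exact: le_trans r1.
  - exact: le_trans b'b.
  - exact: le_trans r3.
  - exact: le_trans d'd.
have x1p : x1 < re p by rewrite /x1 gtrBl.
have px2 : re p < x2 by rewrite /x2 ltrDl.
have y1p : y1 < im p by rewrite /y1 gtrBl.
have py2 : im p < y2 by rewrite /y2 ltrDl.
have x1b := le_trans x12 x2b; have y1d := le_trans y12 y2d.
have cd := le_trans cy1 y1d.
have AE : A = modulus (rect_integral f x1 x2 y1 y2).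
  rewrite /A (rect_integral_split_x c d cf ax1 x1b).
  rewrite (rect_integral_split_x c d cf x12 x2b).
  rewrite (rect_integral_split_y x1 x2 cf cy1 y1d).
  rewrite (rect_integral_split_y x1 x2 cf y12 y2d).
  rewrite (zero a x1 c d)//; last by rewrite /in_rect [re p <= x1]leNgt x1p andbF.
  rewrite (zero x2 b c d)//; last 2 first.
    by rewrite (le_trans ax1).
    by rewrite /in_rect [x2 <= _]leNgt px2.
  rewrite (zero x1 x2 c y1)//; last by rewrite /in_rect [im p <= y1]leNgt y1p !andbF.
  rewrite (zero x1 x2 y2 d)//; last 2 first.
    by rewrite (le_trans cy1).
    by rewrite /in_rect [y2 <= _]leNgt py2 andbF.
  by rewrite !add0r !addr0.
have : A <= 4 * M * ((x2 - x1) + (y2 - y1)).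
  rewrite AE; apply: rect_integral_bound => //; first exact: side_continuousT.
  move=> z /(on_sides_in_rect x12 y12)/andP[/andP[r1 r2] /andP[r3 r4]].
  have zp : modulus (z - p) < del.
    apply: (@le_lt_trans _ _ (h + h)); last first.
      by move: h5 del0; clear => *; lra.
    by apply: modulus_in_box; rewrite ?r1 ?r2 ?r3 ?r4.
  have := delP _ zp; have := modulus_dist (f z) (f p); rewrite /M.
  by move: (modulus (f z)) (modulus (f p)) (modulus (f z - f p)); clear => *; lra.
have -> : 4 * M * (x2 - x1 + (y2 - y1)) = 16 * M * h by rewrite /x1 /x2 /y1 /y2; ring.
move: h6; rewrite ler_pdivlMr ?mulr_gt0//.
have -> : h * (32 * M) = 2 * (16 * M * h) by ring.
have absurd (t u : R) : 0 < t -> 2 * u <= t -> t <= u -> False.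
  by clear => *; lra.
by move=> h7 h8; exact: absurd A0 h7 h8.
Qed.

(** The boundary integral of the function 1 / (w - z), which is 2 i pi at every
    interior [z]. Only the fact that it does not vanish is used, so its value
    is kept as a factor in the Cauchy formula. *)
Definition cauchy_kernel a b c d z : C :=
  rect_integral (fun w => (w - z)^-1) a b c d.

Lemma side_neq a b c d z : in_open_rect a b c d z ->
  forall w, on_sides a b c d w -> w != z.
Proof.
move=> /andP[/andP[az zb] /andP[cz zd]] w; rewrite /on_sides.
case/orP => /andP[_ /orP[]] /eqP wE; apply/eqP => wz; move: wE; rewrite wz => wE.
- by rewrite wE ltxx in cz.
- by rewrite wE ltxx in zd.
- by rewrite wE ltxx in az.
- by rewrite wE ltxx in zb.
Qed.

Lemma side_continuous_div f a b c d z : in_open_rect a b c d z ->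
  side_continuous f a b c d -> side_continuous (fun w => f w / (w - z)) a b c d.
Proof.
move=> /andP[/andP[az zb] /andP[cz zd]] [f1 f2 f3 f4].
have lem (l k : R -> C) : continuous l -> continuous k -> (forall t, k t != z) ->
    continuous (fun t => l t / (k t - z)).
  move=> cl ck kz; apply: (continuousCM cl); apply: continuousCV.
    by move=> t; exact: subC_neq0.
  exact: (continuousCB ck (@continuousCcst R R z)).
split.
- apply: (lem _ _ f1 (@continuous_hline R c)) => t.
  by apply/eqP => tz; move: cz; rewrite -tz ltxx.
- apply: (lem _ _ f2 (@continuous_hline R d)) => t.
  by apply/eqP => tz; move: zd; rewrite -tz ltxx.
- apply: (lem _ _ f3 (@continuous_vline R b)) => t.
  by apply/eqP => tz; move: zb; rewrite -tz ltxx.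
- apply: (lem _ _ f4 (@continuous_vline R a)) => t.
  by apply/eqP => tz; move: az; rewrite -tz ltxx.
Qed.

(** Goursat applied to the difference quotient of [f] at [z], which is
    continuous at [z] and differentiable elsewhere. *)
Lemma Cauchy_formula f a b c d z : continuous f -> in_open_rect a b c d z ->
  (forall w, in_rect a b c d w -> cdifferentiable f w) ->
  f z * cauchy_kernel a b c d z = rect_integral (fun w => f w / (w - z)) a b c d.
Proof.
move=> cf zr df.
have /cdifferentiable_slope[q [qz fq qE]] := df _ (in_open_rectW zr).
have qnear w : w != z ->
    \forall u \near w, (f u - f z) / (u - z) = q u.
  by move=> wz; apply: filterS (near_neqC wz) => u uz; rewrite qE.
have cq : continuous q.
  move=> w; have [->//|wz] := eqVneq w z.
  rewrite /continuous_at (qE _ wz).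
  have wz0 := subC_neq0 wz.
  have h : (fun u => (f u - f z) / (u - z)) @ w --> (f w - f z) / (w - z).
    exact: (cvgCM_at (@cvgC_sub_at R f w _ (f z) (cf w))
      (cvgCV_at wz0 (@cvgC_sub_at R id w _ z (@cvgC_id_at R w)))).
  move/cvgC_nbhsP : h => h; apply/cvgC_nbhsP => e /h[d1 d10 d1P].
  have /nbhsCP[d2 d20 d2P] := qnear _ wz.
  exists (Num.min d1 d2); first by rewrite lt_min d10.
  by move=> u; rewrite lt_min => /andP[/d1P u1 /d2P <-].
have I0 : rect_integral q a b c d = 0.
  apply: (Goursat_except cq zr) => w wr wz.
  apply: (@near_cdifferentiable _ _ _ _ (qnear _ wz)).
  by apply: cdifferentiable_div => //; exact: df.
have scf := @side_continuousT R f a b c d cf.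
have sc1 := side_continuous_div zr (@side_continuousT R (fun=> 1) a b c d (@continuousCcst R C 1)).
have sck : side_continuous (fun w => (w - z)^-1) a b c d.
  by have -> : (fun w => (w - z)^-1) = (fun w => 1 / (w - z)) by
    apply/funext => w; rewrite mul1r.
have scfz := side_continuous_div zr scf.
have scZ : side_continuous (fun w => f z * (w - z)^-1) a b c d.
  case: sck => k1 k2 k3 k4.
  by split; [exact: (continuousCM (@continuousCcst R R (f z)) k1)
    |exact: (continuousCM (@continuousCcst R R (f z)) k2)
    |exact: (continuousCM (@continuousCcst R R (f z)) k3)
    |exact: (continuousCM (@continuousCcst R R (f z)) k4)].
rewrite /cauchy_kernel -(rect_integralZ (f z) sck).
apply/esym/eqP; rewrite -subr_eq0 -(rect_integralB scfz scZ) -I0; apply/eqP.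
apply: eq_rect_integral => w /(side_neq zr) wz.
by rewrite qE// mulrBl.
Qed.

End Cauchy.

(** * Isolation of zeros *)

Section IsolatedZeros.
Local Open Scope complex_scope.
Variable R : realType.
Local Notation C := (Cplx R).
Local Notation re := complex.Re.
Local Notation im := complex.Im.
Local Notation mu := (@lebesgue_measure R).
Implicit Types (f g : C -> C) (a b c d : R) (z w p : C).

Lemma modulus_sqr z : modulus z ^+ 2 = re z ^+ 2 + im z ^+ 2.
Proof. by case: z => x y; rewrite /modulus/= sqr_sqrtr// addr_ge0// sqr_ge0. Qed.

Lemma re_inv z : re z^-1 = re z / modulus z ^+ 2.
Proof. by rewrite modulus_sqr; case: z. Qed.

Lemma im_inv z : im z^-1 = - im z / modulus z ^+ 2.
Proof. by rewrite modulus_sqr; case: z => x y /=; rewrite mulNr. Qed.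

Lemma re_sub z w : re (z - w) = re z - re w.
Proof. by case: z; case: w. Qed.

Lemma im_sub z w : im (z - w) = im z - im w.
Proof. by case: z; case: w. Qed.

Lemma modulus_in_rect a b c d z w : in_rect a b c d z -> in_rect a b c d w ->
  modulus (z - w) <= (b - a) + (d - c).
Proof.
move=> /andP[/andP[r1 r2] /andP[r3 r4]] /andP[/andP[s1 s2] /andP[s3 s4]].
rewrite (le_trans (modulus_le_ReIm _))// re_sub im_sub.
by apply: lerD; rewrite ler_norml; apply/andP; split;
  move: r1 r2 r3 r4 s1 s2 s3 s4; clear => *; lra.
Qed.

(** Each of the four sides contributes a positive amount to the imaginary
    part. *)
Lemma cauchy_kernel_neq0 a b c d z : in_open_rect a b c d z ->
  cauchy_kernel a b c d z != 0.
Proof.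
move=> zr; have /andP[/andP[az zb] /andP[cz zd]] := zr.
have ab := ltW (lt_trans az zb); have cd := ltW (lt_trans cz zd).
have ba0 : 0 < b - a by rewrite subr_gt0 (lt_trans az).
have dc0 : 0 < d - c by rewrite subr_gt0 (lt_trans cz).
pose D := (b - a) + (d - c).
have D0 : 0 < D by rewrite addr_gt0.
have sideD w t : on_sides a b c d w -> 0 < t -> t / D ^+ 2 <= t / modulus (w - z) ^+ 2.
  move=> ws t0; have wz : w != z by exact: side_neq ws.
  rewrite ler_pM2l// lef_pV2 ?posrE ?exprn_gt0// ?modulus_gt0 ?subC_neq0//.
  rewrite lerXn2r ?nnegrE ?modulus_ge0 ?(ltW D0)//.
  by apply: modulus_in_rect; [exact: on_sides_in_rect|exact: in_open_rectW].
have [k1 k2 k3 k4] : side_continuous (fun w => 1 / (w - z)) a b c d.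
  exact: (side_continuous_div zr 
    (@side_continuousT R (fun=> 1) a b c d (@continuousCcst R C 1))).
have D2 t : 0 < t -> 0 < t / D ^+ 2 by move=> t0; rewrite divr_gt0// exprn_gt0.
have kE : (fun w => (w - z)^-1) = (fun w => 1 / (w - z)).
  by apply/funext => w; rewrite mul1r.
have bottom : 0 < \int[mu]_(x in `[a, b]) im (1 / ((x +i* c : C) - z)).
  apply: (@lt_le_trans _ _ ((im z - c) / D ^+ 2 * (b - a))).
    by rewrite mulr_gt0// D2// subr_gt0.
  apply: Rintegral_ge_const => //; first exact: continuous_im_comp k1.
  move=> x xI; rewrite mul1r im_inv im_sub opprB.
  by apply: sideD; [rewrite /on_sides/= xI eqxx|rewrite subr_gt0].
have top : 0 < - \int[mu]_(x in `[a, b]) im (1 / ((x +i* d : C) - z)).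
  rewrite oppr_gt0; apply: (@le_lt_trans _ _ (- ((d - im z) / D ^+ 2) * (b - a))).
    apply: Rintegral_le_const => //; first exact: continuous_im_comp k2.
    move=> x xI; rewrite mul1r im_inv im_sub mulNr lerN2.
    by apply: sideD; [rewrite /on_sides/= xI eqxx orbT|rewrite subr_gt0].
  by rewrite mulNr oppr_lt0 mulr_gt0// D2// subr_gt0.
have right_ : 0 < \int[mu]_(y in `[c, d]) re (1 / ((b +i* y : C) - z)).
  apply: (@lt_le_trans _ _ ((b - re z) / D ^+ 2 * (d - c))).
    by rewrite mulr_gt0// D2// subr_gt0.
  apply: Rintegral_ge_const => //; first exact: continuous_re_comp k3.
  move=> x xI; rewrite mul1r re_inv re_sub.
  by apply: sideD; [rewrite /on_sides/= xI eqxx !orbT|rewrite subr_gt0].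
have left_ : 0 < - \int[mu]_(y in `[c, d]) re (1 / ((a +i* y : C) - z)).
  rewrite oppr_gt0; apply: (@le_lt_trans _ _ (- ((re z - a) / D ^+ 2) * (d - c))).
    apply: Rintegral_le_const => //; first exact: continuous_re_comp k4.
    move=> x xI; rewrite mul1r re_inv re_sub -opprB mulNr lerN2.
    by apply: sideD; [rewrite /on_sides/= xI eqxx !orbT|rewrite subr_gt0].
  by rewrite mulNr oppr_lt0 mulr_gt0// D2// subr_gt0.
apply/eqP => /(congr1 (@complex.Im R)).
rewrite /cauchy_kernel kE /rect_integral /cintegral/= mul0r mul1r add0r => K0.
have := addr_gt0 (addr_gt0 bottom top) (addr_gt0 right_ left_).
by rewrite K0 ltxx.
Qed.

(** A continuous function attains its maximum on the boundary of a rectangle. *)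
Lemma sides_max (phi : C -> R) a b c d : continuous phi -> a <= b -> c <= d ->
  exists2 z0, on_sides a b c d z0 &
    forall z, on_sides a b c d z -> phi z <= phi z0.
Proof.
move=> cphi ab cd.
have hside y : exists2 x0, a <= x0 <= b &
    forall x, a <= x <= b -> phi (x +i* y) <= phi (x0 +i* y).
  have ch : continuous (fun x => phi (x +i* y)).
    by move=> x; exact: (continuous_comp (@continuous_hline R y x) (cphi _)).
  have [x0 x0I x0P] := EVT_max ab (continuous_subspaceT ch).
  by exists x0 => [|x xI]; [|apply: x0P]; rewrite ?in_itv// in x0I *.
have vside x : exists2 y0, c <= y0 <= d &
    forall y, c <= y <= d -> phi (x +i* y) <= phi (x +i* y0).
  have ch : continuous (fun y => phi (x +i* y)).
    by move=> y; exact: (continuous_comp (@continuous_vline R x y) (cphi _)).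
  have [y0 y0I y0P] := EVT_max cd (continuous_subspaceT ch).
  by exists y0 => [|y yI]; [|apply: y0P]; rewrite ?in_itv// in y0I *.
have pick2 p q : on_sides a b c d p -> on_sides a b c d q ->
    exists2 r, on_sides a b c d r & phi p <= phi r /\ phi q <= phi r.
  by move=> ps qs; have [pq|/ltW qp] := leP (phi p) (phi q); [exists q|exists p].
have [x1 x1I x1P] := hside c; have [x2 x2I x2P] := hside d.
have [y1 y1I y1P] := vside a; have [y2 y2I y2P] := vside b.
have [p ps [p1 p2]] : exists2 r, on_sides a b c d r &
    phi (x1 +i* c) <= phi r /\ phi (x2 +i* d) <= phi r.
  by apply: pick2; rewrite /on_sides/= ?x1I ?x2I eqxx ?orbT.
have [q qs [q1 q2]] : exists2 r, on_sides a b c d r &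
    phi (a +i* y1) <= phi r /\ phi (b +i* y2) <= phi r.
  by apply: pick2; rewrite /on_sides/= ?y1I ?y2I eqxx ?orbT.
have [r rs [r1 r2]] := pick2 _ _ ps qs.
exists r => // -[x y]; rewrite /on_sides/=.
case/orP => /andP[xI /orP[]] /eqP E; rewrite E.
- exact: le_trans (x1P _ xI) (le_trans p1 r1).
- exact: le_trans (x2P _ xI) (le_trans p2 r1).
- exact: le_trans (y1P _ xI) (le_trans q1 r2).
- exact: le_trans (y2P _ xI) (le_trans q2 r2).
Qed.

Local Notation square P w r :=
  (P (re w - r) (re w + r) (im w - r) (im w + r)).

Lemma square_center w r : 0 < r -> square (@in_open_rect R) w r w.
Proof. by move=> r0; rewrite /in_open_rect !gtrBl !ltrDl r0. Qed.

Lemma square_side w r z : 0 < r -> square (@on_sides R) w r z -> r <= modulus (z - w).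
Proof.
move=> r0; case/orP => /andP[_] zs.
- apply: le_trans (Im_le_modulus _); rewrite im_sub.
  by case/orP: zs => /eqP ->; rewrite addrAC subrr add0r ?normrN gtr0_norm.
- apply: le_trans (Re_le_modulus _); rewrite re_sub.
  by case/orP: zs => /eqP ->; rewrite addrAC subrr add0r ?normrN gtr0_norm.
Qed.

Lemma disc_in_square w r z : modulus (z - w) < r -> square (@in_open_rect R) w r z.
Proof.
move=> zr; have := le_lt_trans (Re_le_modulus _) zr.
have := le_lt_trans (Im_le_modulus _) zr.
rewrite re_sub im_sub !ltr_norml /in_open_rect => /andP[h1 h2] /andP[h3 h4].
by apply/andP; split; apply/andP; split; move: h1 h2 h3 h4; clear => *; lra.
Qed.

(** The order of the zero of [f] at [w] is read off the Cauchy formula. With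
    I_m(z) the boundary integral of f(u) / ((u - w)^m (u - z)), one has
    I_m(z) = I_m(w) + (z - w) I_{m+1}(z), and I_0(z) is f(z) times a nonzero
    factor. If every I_m(w) vanishes then f(z) is O(|z - w|^m / r^m) for all m,
    so f = 0 near [w]; otherwise the first nonzero one dominates near [w].
    The point [w] itself need not be a zero. *)
Lemma isolated_zeros f w r : 0 < r -> continuous f ->
  (forall z, square (@in_rect R) w r z -> cdifferentiable f z) ->
  (exists2 e : R, 0 < e & forall z, modulus (z - w) < e -> f z = 0) \/
  (exists2 e : R, 0 < e &
    forall z, z != w -> modulus (z - w) < e -> f z != 0).
Proof.
move=> r0 cf df.
pose F := fix F m := if m is k.+1 then fun u => F k u / (u - w) else f.
have wr : square (@in_open_rect R) w r w by exact: square_center.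
have r2 : 0 < r / 2 by rewrite divr_gt0.
have rr : re w - r <= re w + r by move: r0; clear => *; lra.
have ri : im w - r <= im w + r by move: r0; clear => *; lra.
have scF m : square (side_continuous (F m)) w r.
  elim: m => [|m IH]; first exact: side_continuousT.
  exact: side_continuous_div.
have near_r z : modulus (z - w) < r / 2 -> square (@in_open_rect R) w r z.
  by move=> zr; apply: disc_in_square; move: zr r0; move: (modulus _); clear => *; lra.
pose I m z := square (rect_integral (fun u => F m u / (u - z))) w r.
have Irec m z : modulus (z - w) < r / 2 -> I m z = I m w + (z - w) * I m.+1 z.
  move=> /near_r zr.
  have sc := side_continuous_div zr (scF m.+1).
  have scZ : square (side_continuous (fun u => (z - w) * (F m.+1 u / (u - z)))) w r.
    case: sc => k1 k2 k3 k4.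
    by split; [exact: (continuousCM (@continuousCcst R R (z - w)) k1)
      |exact: (continuousCM (@continuousCcst R R (z - w)) k2)
      |exact: (continuousCM (@continuousCcst R R (z - w)) k3)
      |exact: (continuousCM (@continuousCcst R R (z - w)) k4)].
  rewrite /I -(rect_integralZ (z - w) sc) -(rect_integralD (scF m.+1) scZ).
  apply: eq_rect_integral => u us /=.
  have uz0 := subC_neq0 (side_neq zr us).
  have uw0 := subC_neq0 (side_neq wr us).
  by field; rewrite uz0 uw0.
have [z0 _ z0P] := sides_max
  (fun z => continuous_comp (cf z) (@continuous_modulus R (f z))) rr ri.
pose M := modulus (f z0).
have M0 : 0 <= M by exact: modulus_ge0.
have FM m u : square (@on_sides R) w r u -> modulus (F m u) <= M / r ^+ m.
  move=> us; elim: m => [|m IH]; first by rewrite expr0 divr1; exact: z0P.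
  rewrite /= modulusM modulusV exprSr invfM mulrA.
  rewrite ler_pM ?modulus_ge0 ?invr_ge0 ?modulus_ge0//.
  rewrite lef_pV2 ?posrE//; first exact: square_side.
  by apply: modulus_gt0; apply: subC_neq0; exact: side_neq us.
have IM m z : modulus (z - w) < r / 2 -> modulus (I m z) <= 32 * M / r ^+ m.
  move=> zr; have zR := near_r _ zr.
  have -> : 32 * M / r ^+ m =
      4 * (M / r ^+ m * (r / 2)^-1) * (re w + r - (re w - r) + (im w + r - (im w - r))).
    by field; rewrite ?expf_neq0 gt_eqF.
  apply: (rect_integral_bound (side_continuous_div zR (scF m)) rr ri) => u us.
  rewrite modulusM modulusV ler_pM ?modulus_ge0 ?invr_ge0 ?modulus_ge0 ?FM//.
  have uz : r / 2 <= modulus (u - z).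
    have := modulus_dist (u - w) (z - w); have := square_side r0 us; move: zr.
    have -> : u - w - (z - w) = u - z by ring.
    by move: (modulus (z - w)) (modulus (u - w)) (modulus (u - z)); clear => *; lra.
  by rewrite lef_pV2 ?posrE// (lt_le_trans r2).
have Ipow m z : (forall k, (k < m)%N -> I k w = 0) -> modulus (z - w) < r / 2 ->
    f z * square (@cauchy_kernel R) w r z = (z - w) ^+ m * I m z.
  move=> I0 zr; elim: m I0 => [|m IH] I0.
    by rewrite expr0 mul1r; apply: Cauchy_formula => //; exact: near_r.
  rewrite IH; last by move=> k km; apply: I0; rewrite ltnW.
  by rewrite (Irec m z zr) I0// add0r mulrA exprSr.
have [allI0|/existsNP[m0 Im0]] := pselect (forall m, I m w = 0).
  left; exists (r / 2) => // z zr.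
  have fK0 : f z * square (@cauchy_kernel R) w r z = 0.
    apply: modulus_eq0; apply/eqP; rewrite eq_le modulus_ge0 andbT leNgt.
    apply/negP => A0; have [n] := exists_expn_gt (32 * M) A0.
    rewrite ltNge => /negP; apply.
    rewrite (Ipow n z (fun k _ => allI0 k) zr) modulusM modulusX.
    have IMn := IM n z zr.
    apply: (@le_trans _ _ ((r / 2) ^+ n * (32 * M / r ^+ n) * 2 ^+ n)).
      rewrite ler_wpM2r ?exprn_ge0// ler_pM ?exprn_ge0 ?modulus_ge0//.
      by rewrite lerXn2r ?nnegrE ?modulus_ge0 ?(ltW r2)// ltW.
    rewrite expr_div_n le_eqVlt; apply/orP; left; apply/eqP.
    by field; rewrite !expf_neq0 ?gt_eqF.
  by move/eqP: fK0; rewrite mulf_eq0 (negbTE (cauchy_kernel_neq0 (near_r _ zr))) orbF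
    => /eqP.
right.
have exm : exists m, I m w != 0 by exists m0; apply/eqP.
have [m Im mmin] := ex_minnP exm.
have I0 k : (k < m)%N -> I k w = 0.
  by move=> km; apply: contraTeq km => /mmin; rewrite -leqNgt.
pose B := 32 * M / r ^+ m.+1 + 1.
have B0 : 0 < B by rewrite ltr_pwDr// divr_ge0 ?mulr_ge0 ?exprn_ge0// ltW.
have c0 : 0 < modulus (I m w) by exact: modulus_gt0.
exists (Num.min (r / 2) (modulus (I m w) / B)).
  by rewrite lt_min r2 divr_gt0.
move=> z zw; rewrite lt_min => /andP[zr zB]; apply/eqP => fz0.
have /eqP := Ipow m z I0 zr; rewrite fz0 mul0r eq_sym mulf_eq0.
rewrite expf_eq0 (negbTE (subC_neq0 zw)) andbF/= (Irec m z zr).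
rewrite addr_eq0 => /eqP IE.
have : modulus (I m w) < modulus (I m w).
  rewrite {1}IE modulusN modulusM.
  move: zB; rewrite ltr_pdivlMr//; apply: le_lt_trans.
  rewrite ler_wpM2l ?modulus_ge0// (le_trans (IM _ _ zr))// /B lerDl.
  exact: ler01.
by rewrite ltxx.
Qed.

End IsolatedZeros.

(** * The open mapping theorem *)

Section OpenMapping.
Local Open Scope complex_scope.
Variable R : realType.
Local Notation C := (Cplx R).
Local Notation re := complex.Re.
Local Notation im := complex.Im.
Implicit Types (f g : C -> C) (r : R) (z w p : C).
Local Notation square P w r :=
  (P (re w - r) (re w + r) (im w - r) (im w + r)).

Lemma derivable_cdifferentiable f z :
  derivable f z 1 -> cdifferentiable f z.
Proof.
move=> /cvg_ex[/= l /(@cvgCP R C _ _) fl].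
exists l => e e0.
have /nbhsCP[d d0 dP] := fl e e0.
exists d => // w wd; have [->|wz] := eqVneq w z.
  by rewrite !subrr mulr0 subrr modulus0 mulr0.
have wz0 := subC_neq0 wz.
have := dP (w - z); rewrite subr0 => /(_ wd wz0).
rewrite -[(w - z)%:A]/((w - z) * 1) mulr1 subrK -[_ *: _]/((w - z)^-1 * (f w - f z)).
have -> : (w - z)^-1 * (f w - f z) - l = (f w - f z - l * (w - z)) / (w - z).
  by field.
by rewrite modulusM modulusV ltr_pdivrMr ?modulus_gt0// => /ltW.
Qed.

(** The nearest-point projection onto the square of centre [w] and half-side
    [r]. Composing with it makes a function that is continuous on the square
    continuous on the whole plane. *)
Definition clamp w r z : C :=
  Num.max (re w - r) (Num.min (re w + r) (re z)) +i*
  Num.max (im w - r) (Num.min (im w + r) (im z)).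

Lemma continuous_clamp w r : continuous (clamp w r).
Proof.
move=> z; apply: (@cvg_complex R C (nbhs z)).
- apply: (@continuous_max R C (fun=> re w - r)
    (fun z : C => Num.min (re w + r) (re z)) z); first exact: cst_continuous.
  apply: (@continuous_min R C (fun=> re w + r) (fun z : C => re z) z).
    exact: cst_continuous.
  exact: continuous_Re.
- apply: (@continuous_max R C (fun=> im w - r)
    (fun z : C => Num.min (im w + r) (im z)) z); first exact: cst_continuous.
  apply: (@continuous_min R C (fun=> im w + r) (fun z : C => im z) z).
    exact: cst_continuous.
  exact: continuous_Im.
Qed.

Lemma clamp_in_rect w r z : 0 <= r -> square (@in_rect R) w r (clamp w r z).
Proof.
move=> r0; rewrite /in_rect/= !le_max !lexx !ge_max !ge_min !lexx !andbT.
by apply/andP; split; lra.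
Qed.

Lemma clamp_id w r z : square (@in_rect R) w r z -> clamp w r z = z.
Proof.
case: z => x y /andP[/= /andP[h1 h2] /andP[h3 h4]]; rewrite /clamp/=.
by rewrite (min_idPr h2) (min_idPr h4) (max_idPr h1) (max_idPr h3).
Qed.

Lemma cdifferentiable_sub f (k : C) z : cdifferentiable f z ->
  cdifferentiable (fun u => f u - k) z.
Proof.
move=> [l lP]; exists l => e /lP[d d0 dP]; exists d => // w /dP.
by have -> : f w - k - (f z - k) = f w - f z by ring.
Qed.

Lemma in_rect_shrink w r s z : s < r -> square (@in_rect R) w s z ->
  square (@in_open_rect R) w r z.
Proof.
move=> sr /andP[/andP[h1 h2] /andP[h3 h4]].
by apply/andP; split; apply/andP; split; move: h1 h2 h3 h4 sr; clear => *; lra.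
Qed.

Lemma near_in_rect a b c d z : in_open_rect a b c d z ->
  \forall u \near z, in_rect a b c d u.
Proof.
move=> /andP[/andP[h1 h2] /andP[h3 h4]]; apply/nbhsCP.
exists (Num.min (Num.min (re z - a) (b - re z)) (Num.min (im z - c) (d - im z))).
  by rewrite !lt_min !subr_gt0 h1 h2 h3.
move=> u; rewrite !lt_min => /andP[/andP[u1 u2] /andP[u3 u4]].
have := Re_le_modulus (u - z); have := Im_le_modulus (u - z).
rewrite re_sub im_sub !ler_norml => /andP[v1 v2] /andP[v3 v4].
by apply/andP; split; apply/andP; split;
  move: u1 u2 u3 u4 v1 v2 v3 v4; move: (modulus _); clear => *; lra.
Qed.

(** If [f] is not constant near [w], it does not take the value f(w) on the
    boundary of some small square around [w]. A nearby value [c] that [f]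
    omits would make 1 / (f - c) holomorphic, large at [w] and bounded on the
    boundary, against the Cauchy formula. *)
Theorem open_mapping f w r : 0 < r ->
  (forall z, square (@in_rect R) w r z -> cdifferentiable f z) ->
  (exists2 e : R, 0 < e & forall z, modulus (z - w) < e -> f z = f w) \/
  (exists2 e : R, 0 < e & forall c, modulus (c - f w) < e ->
     exists2 z, square (@in_rect R) w r z & f z = c).
Proof.
move=> r0 df; pose g z := f (clamp w r z).
have cin z : square (@in_rect R) w r (clamp w r z) by apply: clamp_in_rect; exact: ltW.
have wr : square (@in_rect R) w r w by apply: in_open_rectW; exact: square_center.
have gw : g w = f w by rewrite /g clamp_id.
have cg : continuous g.
  move=> z; exact: (continuous_comp (@continuous_clamp w r z)
    (cdifferentiable_continuous (df _ (cin z)))).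
have dg s z : s < r -> square (@in_rect R) w s z -> cdifferentiable g z.
  move=> sr /(in_rect_shrink sr) zr.
  apply: (@near_cdifferentiable _ f); last by apply: df; exact: in_open_rectW.
  by apply: filterS (near_in_rect zr) => u ur; rewrite /g clamp_id.
have r20 : 0 < r / 2 by rewrite divr_gt0.
have r2r : r / 2 < r by move: r0; clear => *; lra.
pose h z := g z - f w.
have ch : continuous h := continuousCB cg (@continuousCcst R C (f w)).
have dh z : square (@in_rect R) w (r / 2) z -> cdifferentiable h z.
  by move=> zr; apply: cdifferentiable_sub; exact: dg zr.
have [[e e0 he]|[e e0 he]] := isolated_zeros r20 ch dh.
  left; exists (Num.min e r); first by rewrite lt_min e0.
  move=> z; rewrite lt_min => /andP[/he/eqP ze zr].
  have zR := in_open_rectW (disc_in_square zr).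
  by move: ze; rewrite /h /g clamp_id// subr_eq0 => /eqP.
right.
(* The square of half-side s lies inside the disc of radius e, on which f
   takes the value f w at w only. *)
pose s := Num.min (r / 2) (e / 5).
have s0 : 0 < s by rewrite lt_min r20 divr_gt0.
have sr : s < r by rewrite gt_min r2r.
have se : s <= e / 5 by rewrite ge_min lexx orbT.
have rr : re w - s <= re w + s by move: s0; clear => *; lra.
have ri : im w - s <= im w + s by move: s0; clear => *; lra.
have ws : square (@in_open_rect R) w s w by exact: square_center.
have cnh : continuous (fun z => - modulus (h z)).
  move=> z; apply: (@cvgN R R^o C (nbhs z)).
  exact: (continuous_comp (ch z) (@continuous_modulus R (h z))).
have [z0 z0s z0P] := sides_max cnh rr ri.
pose del := modulus (h z0).
have hdel z : square (@on_sides R) w s z -> del <= modulus (h z).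
  by move=> /z0P; rewrite lerN2.
have del0 : 0 < del.
  apply: modulus_gt0; apply: he; first exact: side_neq z0s.
  have /andP[/andP[h1 h2] /andP[h3 h4]] := on_sides_in_rect rr ri z0s.
  have : modulus (z0 - w) <= s + s by apply: modulus_in_box; rewrite ?h1 ?h3.
  by move: se e0; move: (modulus _); clear => *; lra.
pose K := square (@cauchy_kernel R) w s w.
have K0 : 0 < modulus K by apply: modulus_gt0; exact: cauchy_kernel_neq0.
(* For c this close to f w the modulus of 1 / (f - c) is at most 2 / del on
   the boundary, so its integral against 1 / (z - w) is at most 32 / del,
   whereas K / (f w - c) has modulus above 64 / del. *)
exists (Num.min (del / 2) (modulus K * del / 64)).
  by rewrite lt_min !divr_gt0// mulr_gt0.
move=> c; rewrite lt_min => /andP[c1 c2].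
apply: contrapT => noz.
have gc z : g z != c.
  by apply/eqP => gzc; apply: noz; exists (clamp w r z).
pose k z := (g z - c)^-1.
have ck : continuous k.
  apply: continuousCV; first by move=> z; exact: subC_neq0.
  exact: (continuousCB cg (@continuousCcst R C c)).
have dk z : square (@in_rect R) w s z -> cdifferentiable k z.
  by move=> zs; apply: cdifferentiable_inv => //; exact: dg zs.
have := Cauchy_formula ck ws dk; rewrite -/K => kK.
have : modulus (k w * K) <= 4 * (2 / del * s^-1) * (re w + s - (re w - s) + (im w + s - (im w - s))).
  rewrite kK; apply: rect_integral_bound => //.
    by apply: side_continuous_div => //; exact: side_continuousT.
  move=> z zs; rewrite modulusM !modulusV.
  rewrite ler_pM ?invr_ge0 ?modulus_ge0//; last first.
    by rewrite lef_pV2 ?posrE ?(lt_le_trans s0 (square_side s0 zs))//; exact: square_side.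
  have d2 : del / 2 <= modulus (g z - c).
    have := modulus_dist (h z) (c - f w); have := hdel _ zs; move: c1.
    have -> : h z - (c - f w) = g z - c by rewrite /h; ring.
    have lower (t u v x : R) : t < x / 2 -> x <= u -> u - t <= v -> x / 2 <= v.
      by clear => *; lra.
    exact: lower.
  rewrite -[2 / del]invf_div lef_pV2 ?posrE ?divr_gt0//.
  by rewrite (lt_le_trans _ d2)// divr_gt0.
have -> : 4 * (2 / del * s^-1) * (re w + s - (re w - s) + (im w + s - (im w - s))) = 32 / del.
  by field; rewrite !gt_eqF.
have t0 : 0 < modulus (c - f w).
  by apply: modulus_gt0; apply: subC_neq0; rewrite eq_sym -gw.
rewrite modulusM modulusV gw modulus_sym mulrC ler_pdivrMr//.
have -> : 32 / del * modulus (c - f w) = 32 * modulus (c - f w) / del by ring.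
rewrite ler_pdivlMr//.
have absurd (t u : R) : 0 < t -> t < u / 64 -> u <= 32 * t -> False.
  by clear => *; lra.
exact: absurd t0 c2.
Qed.

End OpenMapping.

(** * Connected, compact and bounded subsets of the plane *)

Section PlaneTopology.
Local Open Scope complex_scope.
Variable R : realType.
Local Notation C := (Cplx R).
Local Notation re := complex.Re.
Local Notation im := complex.Im.
Implicit Types (z w : C) (r : R).

Lemma open_disc w r : open [set z : C | modulus (z - w) < r].
Proof.
rewrite openE => z /= zr; apply/nbhsCP; exists (r - modulus (z - w)).
  by rewrite subr_gt0.
move=> u uz /=; have -> : u - w = (u - z) + (z - w) by ring.
by rewrite (le_lt_trans (modulusD _ _))// -ltrBrDr.
Qed.

Lemma continuous_segment z w : continuous (fun t : R => z + t%:C * (w - z) : C).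
Proof.
apply: (continuousCD (@continuousCcst R R z)).
exact: (continuousCM (@continuous_hline R 0) (@continuousCcst R R (w - z))).
Qed.

Lemma connected_disc w r : connected [set z : C | modulus (z - w) < r].
Proof.
have [r0|r0] := ltP 0 r; last first.
  have -> : [set z : C | modulus (z - w) < r] = set0.
    by rewrite -subset0 => z /= /(le_lt_trans (modulus_ge0 _)); rewrite ltNge r0.
  exact: connected0.
pose seg z := [set w + t%:C * (z - w) | t in `[0 : R, 1]] : set C.
have -> : [set z : C | modulus (z - w) < r] =
    \bigcup_(z in [set z : C | modulus (z - w) < r]) seg z.
  apply/seteqP; split => [z zr|u [z /= zr [t]]].
    exists z => //; exists 1; first by rewrite /= in_itv/= ler01 lexx.
    by rewrite mul1r addrC subrK.
  rewrite /= in_itv/= => /andP[t0 t1] <-.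
  rewrite addrAC subrr add0r modulusM modulus_real ger0_norm//.
  by rewrite (le_lt_trans _ zr)// ler_piMl ?modulus_ge0.
apply: bigcup_connected.
  exists w => z _; exists 0; first by rewrite /= in_itv/= lexx ler01.
  by rewrite mul0r addr0.
move=> z _; apply: connected_continuous_connected.
  exact: segment_connected.
by apply: continuous_subspaceT; exact: continuous_segment.
Qed.

Lemma compact_rect (a b c d : R) : compact [set z : C | in_rect a b c d z].
Proof.
have -> : [set z : C | in_rect a b c d z] =
    [set (p.1 +i* p.2 : C) | p in `[a, b] `*` `[c, d]].
  apply/seteqP; split => [[x y] /andP[/= h1 h2]|z [[x y] [/=]]].
    by exists (x, y); rewrite //= !in_itv/=.
  by rewrite !in_itv/= => h1 h2 <-; rewrite /in_rect/= h1.
apply: continuous_compact; last first.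
  by apply: compact_setX; exact: segment_compact.
apply: continuous_subspaceT => p.
by apply: (@cvg_complex R _ (nbhs p)); [exact: cvg_fst|exact: cvg_snd].
Qed.

Lemma bounded_setCP (A : set C) :
  bounded_set A <-> exists M : R, forall z, A z -> modulus z <= M.
Proof.
split=> [[M [Mr /(_ (M + 1))]]|[M MA]].
  rewrite ltrDl ltr01 => /(_ isT) AM; exists (re (M + 1)) => z /AM /=.
  by rewrite normC_modulus lecE => /andP[].
exists M%:C; split; first by rewrite complex_real.
move=> x Mx z /MA zM /=; rewrite normC_modulus (le_trans _ (ltW Mx))//.
by rewrite lecR.
Qed.

Lemma compact_square (M : R) :
  compact [set z : C | in_rect (- M) M (- M) M z] /\
  closed [set z : C | in_rect (- M) M (- M) M z].
Proof.
split; first exact: compact_rect.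
by apply: compact_closed; [exact: norm_hausdorff|exact: compact_rect].
Qed.

End PlaneTopology.

(** * Fatou components and their images *)

Section Fatou.
Local Open Scope complex_scope.
Variable R : realType.
Local Notation C := (Cplx R).
Local Notation S := (sphere R).
Local Notation re := complex.Re.
Local Notation im := complex.Im.
Implicit Types (f : C -> S) (z w : C) (p q : S) (V W : set S).

Lemma nbhs_fatou f p : fatou_set f p -> nbhs p (fatou_set f).
Proof.
move=> [U [Up Ud Un]]; apply: filterS (open_nbhs_nbhs Up) => q Uq.
by exists U; split => //; split => //; case: Up.
Qed.

Lemma fatou_finite f p : fatou_set f p -> exists x, p = Some x.
Proof.
move=> [U [[_ Up] Ud _]]; case: p Up => [x|] Up; first by exists x.
by have := Ud 1%N _ Up 0%N isT.
Qed.

(** Fatou components are open, because the plane is locally connected. *)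
Lemma nbhs_component f V p : fatou_component f V -> V p -> nbhs p V.
Proof.
move=> [p0 _ ->] Vp; have Fp := connected_component_sub Vp.
have [x px] := fatou_finite Fp; rewrite {}px in Vp Fp *.
have /nbhsCP[e e0 eF] := nbhs_fatou Fp.
apply/nbhsCP; exists e => // w we.
have xD : connected_component (fatou_set f) (Some x) (Some w).
  exists (Some @` [set u : C | modulus (u - x) < e]); last by exists w.
  split.
  - by exists x => //=; rewrite subrr modulus0.
  - by move=> _ [u /= /eF Fu <-].
  - apply: connected_continuous_connected; first exact: connected_disc.
    by apply: continuous_subspaceT; exact: one_point_compactification_some_continuous.
exact: connected_component_trans xD.
Qed.

Lemma component_eq f V V' p : fatou_component f V -> fatou_component f V' ->
  V p -> V' p -> V = V'.
Proof.
move=> [q _ ->] [q' _ ->] /same_connected_component -> /same_connected_component.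
by move=> ->.
Qed.

(** A Fatou point is not a pole, since its second iterate is defined. *)
Lemma fatou_holomorphic f x : transcendental_meromorphic f ->
  fatou_set f (Some x) -> exists g : C -> C, \forall w \near x,
    f w = Some (g w) /\ cdifferentiable g w.
Proof.
move=> [mf _] [U [[_ Ux] Ud _]].
have fx : f x <> None by exact: (Ud 2%N _ Ux 1%N isT).
case: (mf x) => [[g gP]|[fN]]; last by rewrite fN in fx.
exists g; apply: filterS gP => w [fw /derivable_cdifferentiable gw].
by split.
Qed.

Lemma iterate_extend f n p : iterate f n.+1 p = iterate f n (extend f p).
Proof. by rewrite /iterate iterSr. Qed.

(** The image of a Fatou point is a Fatou point unless [f] is constant nearby.
    By the open mapping theorem a disc around f(x) is covered by the image of a
    compact square around [x] inside the Fatou set; the convergence of iterates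
    on the square, uniform by compactness, is carried over to the disc by a
    choice of preimages. *)
Lemma fatou_image f x : transcendental_meromorphic f ->
  fatou_set f (Some x) ->
  (\forall w \near x, f w = f x) \/ fatou_set f (f x).
Proof.
move=> tf Fx; have [g /nbhsCP[e1 e10 gP]] := fatou_holomorphic tf Fx.
move: Fx => [U [[oU Ux] Ud Un]].
have /nbhsCP[e2 e20 UP] : nbhs x (Some @^-1` U).
  exact: (@open_nbhs_nbhs _ (Some x : S) U (conj oU Ux)).
pose e := Num.min e1 e2; have e0 : 0 < e by rewrite lt_min e10.
pose r := e / 3; have r0 : 0 < r by rewrite divr_gt0.
pose Q := [set z : C | in_rect (re x - r) (re x + r) (im x - r) (im x + r) z].
have Qe z : Q z -> modulus (z - x) < e.
  move=> /andP[h1 h2]; apply: le_lt_trans (modulus_in_box h1 h2) _.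
  by rewrite /r; move: e0; clear => *; lra.
have Qg z : Q z -> f z = Some (g z) /\ cdifferentiable g z.
  by move=> /Qe; rewrite lt_min => /andP[/gP].
have QU z : Q z -> U (Some z).
  by move=> /Qe; rewrite lt_min => /andP[_ /UP].
have gx : f x = Some (g x).
  by have [] := gP x _ => //; rewrite subrr modulus0.
have [[d d0 dP]|[d d0 dP]] := open_mapping r0 (fun z zQ => (Qg z zQ).2).
  left; apply/nbhsCP; exists (Num.min d e1); first by rewrite lt_min d0.
  move=> w; rewrite lt_min gx => /andP[/dP gw /gP[-> _]].
  by rewrite gw.
right; rewrite gx.
pose D := [set c : C | modulus (c - g x) < d].
have /choice[pre preP] : forall c, exists z, D c -> Q z /\ g z = c.
  move=> c; have [Dc|nDc] := pselect (D c); last by exists 0.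
  by have [z zQ zc] := dP c Dc; exists z.
exists (Some @` D); split.
- split; last by exists (g x) => //=; rewrite /D/= subrr modulus0.
  by apply: one_point_compactification_open_some; exact: open_disc.
- move=> n _ [c /preP[cQ cE] <-] k kn.
  rewrite -cE -(Qg _ cQ).1 -[f _]/(extend f (Some (pre c))) -iterate_extend.
  by apply: (Ud n.+1) => //; exact: QU.
move=> u uit.
have /choice[N NP] : forall n, exists m, u n = iterate f m.
  by move=> n; have [m _ <-] := uit n; exists m.
have [] := Un (fun n => iterate f (N n).+1).
  by move=> n; exists (N n).+1.
move=> phi [phi_incr [G GP]]; exists phi; split => //.
exists (fun q => if q is Some c then G (Some (pre c)) else None).
move=> _ [c0 Dc0 <-]; exists setT; first exact: filterT.
move=> eps eps0.
have cQ : compact Q by exact: compact_rect.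
have unif : \forall k \near \oo, Q `<=` [set z |
    chordal (iterate f (N (phi k)).+1 (Some z)) (G (Some z)) < eps].
  move/compact_near_coveringP : cQ => /(_ nat \oo (fun k z =>
    chordal (iterate f (N (phi k)).+1 (Some z)) (G (Some z)) < eps)); apply.
  move=> z zQ; have [V zV VP] := GP _ (QU z zQ).
  have nV : \forall w \near z, U (Some w) /\ V (Some w).
    apply: (@filterI C (nbhs z)); last exact: zV.
    exact: (@open_nbhs_nbhs _ (Some z : S) U (conj oU (QU z zQ))).
  exists ([set w : C | U (Some w) /\ V (Some w)], [set k | forall w : S, (U `&` V) w ->
      chordal (iterate f (N (phi k)).+1 w) (G w) < eps]).
    by split => //; exact: VP.
  by move=> [w k] [/= [Uw Vw] kP]; exact: kP.
apply: filterS unif => k kP _ [[c Dc <-] _].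
have [cQ' cE] := preP _ Dc.
have kPc : chordal (iterate f (N (phi k)).+1 (Some (pre c)))
  (G (Some (pre c))) < eps := kP _ cQ'.
move: kPc; rewrite iterate_extend -[extend f (Some _)]/(f (pre c)).
by rewrite (Qg _ cQ').1 cE NP.
Qed.

Lemma fatou_continuous f x (P : set S) : transcendental_meromorphic f ->
  fatou_set f (Some x) -> nbhs (f x) P -> \forall w \near x, P (f w).
Proof.
move=> tf Fx; have [g gP] := fatou_holomorphic tf Fx.
have [fx dg] := nbhs_singleton gP; rewrite fx => nP.
have nPg : \forall w \near x, P (Some (g w)).
  exact: (cdifferentiable_continuous dg nP).
by apply: filterS2 gP nPg => w [-> _].
Qed.

(** If [f] maps one point of a Fatou component [V] into the component [V'], it
    maps [V] into [V']: both the points sent into [V'] and those sent outside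
    form open sets. Where [f] is locally constant this is clear without
    [fatou_image], so that the identity theorem is not needed. *)
Lemma component_image f V V' p : transcendental_meromorphic f ->
  fatou_component f V -> fatou_component f V' -> V p -> V' (extend f p) ->
  forall q, V q -> V' (extend f q).
Proof.
move=> tf cV cV' Vp V'p.
have VF q : V q -> fatou_set f q.
  by case: cV => [q0 _ ->]; exact: connected_component_sub.
have near_in q : V q -> V' (extend f q) -> \forall w \near q, V' (extend f w).
  move=> Vq; have [x qx] := fatou_finite (VF _ Vq); rewrite {}qx in Vq *.
  move=> V'x; have := fatou_continuous tf (VF _ Vq) (nbhs_component cV' V'x).
  exact.
have near_out q : V q -> ~ V' (extend f q) -> \forall w \near q, ~ V' (extend f w).
  move=> Vq; have [x qx] := fatou_finite (VF _ Vq); rewrite {}qx in Vq *.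
  move=> V'x; have [fc|Ffx] := fatou_image tf (VF _ Vq).
    have : \forall w \near x, ~ V' (f w) by apply: filterS fc => w ->.
    by [].
  have cK : fatou_component f (connected_component (fatou_set f) (f x)).
    by exists (f x).
  have nK : nbhs (f x) (connected_component (fatou_set f) (f x)).
    by apply: (nbhs_component cK); exact: connected_component_refl.
  have := fatou_continuous tf (VF _ Vq) nK.
  apply: filterS => w Kw V'w; apply: V'x; rewrite (component_eq cV' cK V'w Kw).
  exact: connected_component_refl.
have conV : connected V by case: cV => [q0 _ ->]; exact: component_connected.
pose A := [set q | V' (extend f q)].
have VA : V `&` A^° = V.
  apply: conV; first by exists p; split => //; exact: near_in.
    by exists A^° => //; exact: open_interior.
  exists (~` (~` A)^°); first exact/open_closedC/open_interior.
  apply/seteqP; split => q [Vq Aq]; split => //.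
    by move=> /interior_subset; apply; exact: interior_subset Aq.
  apply: near_in => //; apply: contrapT => nA; apply: Aq.
  exact: near_out.
by move=> q; rewrite -{1}VA => -[_ /interior_subset].
Qed.

End Fatou.

(** * Baker wandering domains and unbounded curves *)

Section BakerDomains.
Local Open Scope complex_scope.
Variable R : realType.
Local Notation C := (Cplx R).
Local Notation S := (sphere R).
Implicit Types (f : C -> S) (z w : C) (p q : S) (V W : set S).

Lemma cdist_le V z : V (Some z) -> cdist V 0 <= modulus z.
Proof.
move=> Vz; rewrite -[z in modulus z]subr0.
have lb : has_lbound [set modulus (w - 0) | w in [set w : C | V (Some w)]].
  by exists 0 => _ [w _ <-]; exact: modulus_ge0.
by apply: (ge_inf lb); exists z.
Qed.

(** An empty set has distance [inf set0 = 0] to the origin, so a positive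
    distance rules out the default value of [image_component]. *)
Lemma image_component_spec f W n : 0 < cdist (image_component f W n) 0 ->
  fatou_component f (image_component f W n) /\
  iterate f n @` W `<=` image_component f W n.
Proof.
move=> dW; pose P := [set V | fatou_component f V /\ iterate f n @` W `<=` V].
have [exV|/forallNP noV] := pselect (exists V, P V); first exact: (xgetPex set0 exV).
move: dW; rewrite /image_component (xgetPN _ noV).
have -> : cdist (set0 : set S) (0 : C) = 0; last by rewrite ltxx.
rewrite /cdist; have -> : [set modulus (w - 0) | w in [set w : C | (set0 : set S) (Some w)]] = set0.
  by apply/seteqP; split => [y [w []]|y []].
exact: inf0.
Qed.

(** f(W_n) is contained in W_{n+1} as soon as both W_n and W_{n+1} are at a
    positive distance from 0. *)
Lemma baker_image f W n : transcendental_meromorphic f ->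
  baker_wandering_domain f W ->
  0 < cdist (image_component f W n) 0 -> 0 < cdist (image_component f W n.+1) 0 ->
  forall q, image_component f W n q -> image_component f W n.+1 (extend f q).
Proof.
move=> tf [[[p0 Fp0 WE] _] _ _ _] /image_component_spec[c1 i1].
move=> /image_component_spec[c2 i2].
have Wp : W p0 by rewrite WE; exact: connected_component_refl.
apply: (component_image tf c1 c2 (p := iterate f n p0)); first by apply: i1; exists p0.
by apply: i2; exists p0.
Qed.

(** The disc around 0 of radius dist(V, 0) misses [V] and contains [z]. If the
    connected set [A] missed [V] too, the union of both would lie in the
    bounded component of the complement that contains 0. *)
Lemma surrounds_meets V (A : set C) z : surrounds V [set (Some 0 : S)] ->
  modulus z < cdist V 0 -> connected A -> A z -> ~ bounded_set A ->
  exists2 w, A w & V (Some w).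
Proof.
move=> [K [[k0 _ KE] [B bB KB] K0]] zV conA Az nbA; apply: contrapT => noV.
have K00 : K (Some 0) by exact: K0.
pose D := [set w : C | modulus (w - 0) < cdist V 0].
have DV w : D w -> ~ V (Some w).
  by rewrite /D/= subr0 => Dw /cdist_le; rewrite leNgt Dw.
have Dz : D z by rewrite /D/= subr0.
have D0 : D (0 : C).
  apply: le_lt_trans zV; rewrite -[X in X <= _]/(modulus (0 - 0 : C)) subr0.
  by rewrite modulus0 modulus_ge0.
have conDA : connected (Some @` (D `|` A) : set S).
  apply: connected_continuous_connected.
    by apply: connectedU => //; [exists z|exact: connected_disc].
  by apply: continuous_subspaceT; exact: one_point_compactification_some_continuous.
have DAK : Some @` (D `|` A) `<=` K.
  rewrite KE in K00 *.
  rewrite (same_connected_component K00).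
  apply: (@connected_component_max S (~` V) _ (Some 0) _ _ conDA).
    by exists 0 => //; left.
  move=> _ [w [Dw|Aw] <-]; first exact: DV.
  by move=> Vw; apply: noV; exists w.
apply: nbA; move/bounded_setCP : bB => [M BM]; apply/bounded_setCP; exists M.
move=> w Aw; have : K (Some w) by apply: DAK; exists w => //; right.
by move=> /KB[b Bb [<-]]; exact: BM.
Qed.

Lemma baker_unbounded_curve f : transcendental_meromorphic f ->
  (exists W, baker_wandering_domain f W) ->
  forall (I : interval R) (gamma : R -> C),
    {within [set` I], continuous gamma} ->
    ~ bounded_set (gamma @` [set` I]) ->
    ~ sphere_bounded (f @` (gamma @` [set` I])).
Proof.
move=> tf [W bW] I gamma cgamma ngamma [B /bounded_setCP[M BM] fB].
have conA : connected (gamma @` [set` I]).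
  apply: connected_continuous_connected => //.
  exact/connected_intervalP/interval_is_interval.
have [A0|[z Az]] : gamma @` [set` I] = set0 \/ gamma @` [set` I] !=set0.
  by have [->|/set0P] := eqVneq (gamma @` [set` I]) set0; [left|right].
  by apply: ngamma; rewrite A0; apply/bounded_setCP; exists 0.
have [_ /= Wn /cvgryPgt Wd _] := bW.
pose L := Num.max (modulus z) (Num.max M 0).
have [N1 _ N1P] := Wn; have [N2 _ N2P] := Wd L.
pose n := maxn N1 N2.
have [_ _ sn] := N1P n (leq_maxl _ _).
have dn : L < cdist (image_component f W n) 0 by apply: N2P; exact: leq_maxr.
have dn1 : L < cdist (image_component f W n.+1) 0.
  by apply: N2P => /=; rewrite (leq_trans (leq_maxr N1 N2)).
have L0 : 0 <= L by rewrite !le_max lexx !orbT.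
have zn : modulus z < cdist (image_component f W n) 0.
  by apply: le_lt_trans dn; rewrite le_max lexx.
have [w Aw Vw] := surrounds_meets sn zn conA Az ngamma.
have V1w := baker_image tf bW (le_lt_trans L0 dn) (le_lt_trans L0 dn1) Vw.
have [b Bb bE] : [set (Some b : S) | b in B] (f w) by apply: fB; exists w.
move: V1w; rewrite /= -bE => /cdist_le.
rewrite leNgt => /negP; apply; apply: le_lt_trans dn1.
by rewrite (le_trans (BM _ Bb))// !le_max lexx !orbT.
Qed.

Lemma no_baker_of_asymptotic_value f : transcendental_meromorphic f ->
  (exists a : C, asymptotic_value f (Some a)) ->
  ~ exists W, baker_wandering_domain f W.
Proof.
move=> tf [a [gamma [cgamma gammaoo fgamma]]] bW.
have nfa : nbhs (Some a : S) (Some @` [set w : C | modulus (w - a) < 1]).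
  apply: one_point_compactification_some_nbhs; apply/nbhsCP.
  by exists 1.
have [T [_ TP]] := fgamma _ nfa.
pose T' := Num.max T 0 + 1.
apply: (baker_unbounded_curve tf bW (I := `[T', +oo[) (gamma := gamma)).
- apply: continuous_subspaceW cgamma => t /=; rewrite !in_itv/= !andbT.
  by apply: le_trans; rewrite addr_ge0// le_max lexx orbT.
- move=> /bounded_setCP[M MP].
  have nM : nbhs (None : S)
      (Some @` (~` [set z : C | in_rect (- M) M (- M) M z]) `|` [set None]).
    by exists [set z : C | in_rect (- M) M (- M) M z] => //; exact: compact_square.
  have [T2 [_ T2P]] := gammaoo _ nM.
  pose t := Num.max T' T2 + 1.
  have tT2 : T2 < t by rewrite /t ltr_pwDr// le_max lexx orbT.
  have tT' : T' <= t by rewrite ler_wpDr// le_max lexx.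
  have [[w wM /= [wE]]|//] := T2P t tT2.
  apply: wM; rewrite /= wE.
  have gM : modulus (gamma t) <= M.
    by apply: MP; exists t => //=; rewrite in_itv/= andbT.
  have := le_trans (Re_le_modulus _) gM; have := le_trans (Im_le_modulus _) gM.
  by rewrite !ler_norml /in_rect => -> ->.
- exists [set w : C | modulus (w - a) < 1].
    apply/bounded_setCP; exists (modulus a + 1) => w /= wa.
    by rewrite -lerBlDl (le_trans (modulus_dist _ _))// ltW.
  move=> _ [_ [t /= tT <-] <-]; apply: TP.
  rewrite in_itv/= andbT in tT; apply: lt_le_trans tT.
  by rewrite /T' ltr_pwDr// le_max lexx.
Qed.

End BakerDomains.

Unset Implicit Arguments.

Theorem proposition3p4 (R : realType) :
  (forall f : Cplx R -> sphere R,
     transcendental_meromorphic f ->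
     (exists W : set (sphere R), baker_wandering_domain f W) ->
     forall (I : interval R) (gamma : R -> Cplx R),
       {within [set` I], continuous gamma} ->
       ~ bounded_set (gamma @` [set` I]) ->
       ~ sphere_bounded (f @` (gamma @` [set` I]))) /\
  (forall f : Cplx R -> sphere R,
     transcendental_meromorphic f ->
     (exists a : Cplx R, asymptotic_value f (Some a)) ->
     ~ exists W : set (sphere R), baker_wandering_domain f W).
Proof.
split=> f tf; first exact: baker_unbounded_curve.
exact: no_baker_of_asymptotic_value.
Qed.
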